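(* Assume that $\operatorname{supp}\rho_{0,n}\le\operatorname{supp}\rho_{1,n}$ for all $n\in\mathbb N$. Then $$\underline{s}_G(\rho_0\,\|\,\rho_1)=\overline{s}_G(\rho_0\,\|\,\rho_1)=s_G(\rho_0\,\|\,\rho_1)=-S_M(\rho_0\,\|\,\rho_1).$$
   Context: Let $\mathcal H$ be a finite-dimensional complex Hilbert space, $G$ a compact group and $g\mapsto u_g$ a continuous unitary representation of $G$ on $\mathcal H$. For $n\in\mathbb N$ let $\mathcal A_n=\{A\in\mathcal B(\mathcal H^{\otimes n}):Au_g^{\otimes n}=u_g^{\otimes n}A\ \forall g\in G\}$ and $E_{\mathcal A_n}(X)=\int_G u_g^{\otimes n}Xu_g^{*\otimes n}\,dg$ (normalized Haar measure). Let $\rho_0,\rho_1$ be states on $\mathcal B(\mathcal H)$ with density matrices $\hat\rho_0,\hat\rho_1$, and let $\rho_{k,n}$ be the state on $\mathcal B(\mathcal H^{\otimes n})$ with density $\hat\rho_{k,n}:=E_{\mathcal A_n}(\hat\rho_k^{\otimes n})$, $k=0,1$; $\operatorname{supp}\rho_{k,n}$ denotes the support projection of $\hat\rho_{k,n}$. A $G$-invariant test is a sequence $\{T_n\}$ with $T_n\in\mathcal A_n$, $0\le T_n\le I$; its error probabilities are $\beta_{0,n}(T_n)=\operatorname{Tr}\hat\rho_0^{\otimes n}(I-T_n)$ and $\beta_{1,n}(T_n)=\operatorname{Tr}\hat\rho_1^{\otimes n}T_n$. Define $\underline s_G(\rho_0\|\rho_1)$, $\overline s_G(\rho_0\|\rho_1)$,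 $s_G(\rho_0\|\rho_1)$ as the infimum, over all $G$-invariant test sequences with $\lim_{n\to\infty}\beta_{0,n}(T_n)=0$, of respectively $\liminf_n\frac1n\log\beta_{1,n}(T_n)$, $\limsup_n\frac1n\log\beta_{1,n}(T_n)$, and $\lim_n\frac1n\log\beta_{1,n}(T_n)$ (the last infimum being over those sequences for which this limit exists). The relative entropy is $S(\rho\|\sigma)=\operatorname{Tr}\hat\rho(\log\hat\rho-\log\hat\sigma)$ if $\operatorname{supp}\rho\le\operatorname{supp}\sigma$ and $+\infty$ otherwise, and $S_M(\rho_0\|\rho_1):=\lim_{n\to\infty}\frac1n S(\rho_{0,n}\|\rho_{1,n})$ (this limit exists and equals $\sup_n\frac1nS(\rho_{0,n}\|\rho_{1,n})$). *)

(* Defs.v *)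
From HB Require Import structures.
From mathcomp Require Import all_boot all_order all_algebra.
From mathcomp Require Import all_classical all_reals all_analysis.
From mathcomp Require Import complex mxtens.

Set Implicit Arguments.
Unset Strict Implicit.
Unset Printing Implicit Defensive.

Import Order.TTheory GRing.Theory Num.Theory.
Import numFieldTopology.Exports numFieldNormedType.Exports.
Local Open Scope classical_set_scope.
Local Open Scope ring_scope.

Section QHT.
Variable R : realType.
Local Notation C := (R[i]).

Definition compact_group (G : ptopologicalType) (mul : G -> G -> G)
    (inv : G -> G) (one : G) : Prop :=
  [/\ associative mul, left_id one mul & left_inverse one inv mul] /\
  [/\ continuous (fun p : G * G => mul p.1 p.2), continuous inv,
      hausdorff_space G & compact [set: G]].

Definition borel (G : ptopologicalType) := g_sigma_algebraType (@open G).

Definition normalized_haar (G : ptopologicalType) (mul : G -> G -> G)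
    (mu : {measure set (borel G) -> \bar R}) : Prop :=
  mu setT = 1%E /\
  forall (g : G) (A : set (borel G)), measurable A ->
    mu ((mul g) @` A) = mu A.

Definition cintegral (G : ptopologicalType)
    (mu : {measure set (borel G) -> \bar R}) (f : G -> C) : C :=
  Complex (Rintegral mu setT (fun g => complex.Re (f g)))
          (Rintegral mu setT (fun g => complex.Im (f g))).

Definition adj m n (A : 'M[C]_(m, n)) : 'M[C]_(n, m) := (map_mx (@Num.Def.conjC C) A)^T.

Definition unitary m (U : 'M[C]_m) : Prop := U *m adj U = 1%:M.

Definition psd m (A : 'M[C]_m) : Prop :=
  adj A = A /\ forall v : 'rV[C]_m, 0 <= (v *m A *m adj v) 0 0.

Definition loewner_le m (A B : 'M[C]_m) : Prop := psd (B - A).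

Definition density m (A : 'M[C]_m) : Prop := psd A /\ \tr A = 1.

Definition tpow d (A : 'M[C]_d) (n : nat) : 'M[C]_(d ^ n) := ntensmx A n.

(* functional calculus f(A) for a Hermitian (normal) matrix A, through the
   spectral decomposition A = P^-1 diag(sp) P of mathcomp's spectral.v *)
Definition mx_fun m (f : R -> R) (A : 'M[C]_m) : 'M[C]_m :=
  invmx (spectralmx A)
  *m diag_mx (map_mx (fun z : C => real_complex R (f (complex.Re z))) (spectral_diag A))
  *m spectralmx A.

Definition supp m (A : 'M[C]_m) : 'M[C]_m :=
  mx_fun (fun x => if x == 0 then 0 else 1) A.

(* matrix logarithm on the support (log 0 := 0, i.e. log restricted to the support) *)
Definition mlog m (A : 'M[C]_m) : 'M[C]_m :=
  mx_fun (fun x => if 0 < x then ln x else 0) A.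

Definition relent m (rho sigma : 'M[C]_m) : \bar R :=
  if `[< loewner_le (supp rho) (supp sigma) >] then
    (complex.Re (\tr (rho *m (mlog rho - mlog sigma))))%:E
  else +oo%E.

Definition elog (x : R) : \bar R := if 0 < x then (ln x)%:E else -oo%E.

Section Setting.
Variables (G : ptopologicalType) (mul : G -> G -> G) (inv : G -> G) (one : G).
Variable (mu : {measure set (borel G) -> \bar R}).
Variables (d : nat) (u : G -> 'M[C]_d).

Definition unitary_rep : Prop :=
  [/\ forall g h, u (mul g h) = u g *m u h,
      u one = 1%:M,
      forall g, unitary (u g),
      forall i j, continuous ((fun g => complex.Re (u g i j)) : G -> R)
    & forall i j, continuous ((fun g => complex.Im (u g i j)) : G -> R)].

Definition in_An n (A : 'M[C]_(d ^ n)) : Prop :=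
  forall g, A *m tpow (u g) n = tpow (u g) n *m A.

Definition EA n (X : 'M[C]_(d ^ n)) : 'M[C]_(d ^ n) :=
  \matrix_(i, j) cintegral mu
     (fun g => (tpow (u g) n *m X *m adj (tpow (u g) n)) i j).

Definition rho_n (rho : 'M[C]_d) n : 'M[C]_(d ^ n) := EA (tpow rho n).

Definition ginv_test (T : forall n, 'M[C]_(d ^ n)) : Prop :=
  forall n, in_An (T n) /\ loewner_le 0 (T n) /\ loewner_le (T n) 1%:M.

Variables (rho0 rho1 : 'M[C]_d).

Definition beta0 n (Tn : 'M[C]_(d ^ n)) : R :=
  complex.Re (\tr (tpow rho0 n *m (1%:M - Tn))).
Definition beta1 n (Tn : 'M[C]_(d ^ n)) : R :=
  complex.Re (\tr (tpow rho1 n *m Tn)).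

Definition rate (T : forall n, 'M[C]_(d ^ n)) (n : nat) : \bar R :=
  (((n%:R)^-1)%:E * elog (beta1 (T n)))%E.

Definition admissible (T : forall n, 'M[C]_(d ^ n)) : Prop :=
  ginv_test T /\ (fun n => beta0 (T n)) @ \oo --> (0 : R).

Definition s_lower : \bar R :=
  ereal_inf [set x | exists T, admissible T /\ x = limn_einf (rate T)].
Definition s_upper : \bar R :=
  ereal_inf [set x | exists T, admissible T /\ x = limn_esup (rate T)].
Definition s_lim : \bar R :=
  ereal_inf [set x | exists T, admissible T /\ rate T @ \oo --> x].

Definition S_M : \bar R :=
  limn (fun n => (((n%:R)^-1)%:E * relent (rho_n rho0 n) (rho_n rho1 n))%E).

End Setting.
End QHT.

(* Main.v *)
Require Import Defs.
From HB Require Import structures.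
From mathcomp Require Import all_boot all_order all_algebra.
From mathcomp Require Import all_classical all_reals all_analysis.
From mathcomp Require Import measurable_realfun complex mxtens ring lra.
Set Implicit Arguments.
Unset Strict Implicit.
Unset Printing Implicit Defensive.
Import Order.TTheory GRing.Theory Num.Theory.
Import numFieldTopology.Exports numFieldNormedType.Exports.
Local Open Scope classical_set_scope.
Local Open Scope ring_scope.

(** Write [x n] for the relative entropy of the averaged [n]-fold states.

    Converse: an invariant test sees only the averaged states. Expanding it in
    their two eigenbases (Nussbaum and Szkola) compares its errors with those of
    a classical pair of distributions with the same relative entropy, so
    vanishing first error forces the second error above [exp (- n (s + e))] for
    all large [n] such that [x n <= n s].

    Direct part: fix a block length [m]. On [k] blocks let [P] and [Q] be the
    spectral projections of the tensor powers of the averaged states on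
    [eigenvalue >= c^k] and [eigenvalue <= t^k]. The projection onto the range
    of [Q P] is invariant under independent group actions on the blocks, has
    rank at most that of [P], and by Chernoff bounds for the two eigenvalue
    distributions has first error exponentially small and second error at most
    [exp (- k b)] for any [b < x m]. So every rate below [sup x m / m] is
    achieved, and the converse applied to these tests shows that [x n / n]
    converges to that supremum. *)

(** * Adjoints and squared moduli *)

Section Adjoint.
Variable R : realType.
Local Notation C := R[i].

Lemma adjE m n (A : 'M[C]_(m, n)) i j : adj A i j = Num.conj (A j i).
Proof. by rewrite !mxE. Qed.

Lemma adjK m n (A : 'M[C]_(m, n)) : adj (adj A) = A.
Proof. by apply/matrixP => i j; rewrite !adjE conjCK. Qed.

Lemma adjM m n p (A : 'M[C]_(m, n)) (B : 'M[C]_(n, p)) :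
  adj (A *m B) = adj B *m adj A.
Proof. by rewrite /adj map_mxM trmx_mul. Qed.

Lemma adjD m n (A B : 'M[C]_(m, n)) : adj (A + B) = adj A + adj B.
Proof. by rewrite /adj map_mxD linearD. Qed.

Lemma adjN m n (A : 'M[C]_(m, n)) : adj (- A) = - adj A.
Proof. by rewrite /adj map_mxN linearN. Qed.

Lemma adjB m n (A B : 'M[C]_(m, n)) : adj (A - B) = adj A - adj B.
Proof. by rewrite adjD adjN. Qed.

Lemma adj_mx1 n : adj (1%:M : 'M[C]_n) = 1%:M.
Proof. by rewrite /adj map_mx1 trmx1. Qed.

Lemma adj0 m n : adj (0 : 'M[C]_(m, n)) = 0.
Proof. by rewrite /adj map_mx0 trmx0. Qed.

Lemma unitaryV m (U : 'M[C]_m) : unitary U -> adj U *m U = 1%:M.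
Proof. exact: mulmx1C. Qed.

Lemma unitary_adj m (U : 'M[C]_m) : unitary U -> unitary (adj U).
Proof. by move=> /unitaryV hU; rewrite /unitary adjK. Qed.

Lemma unitary_mul m (U V : 'M[C]_m) : unitary U -> unitary V -> unitary (U *m V).
Proof.
move=> hU hV; rewrite /unitary adjM mulmxA -(mulmxA U) hV mulmx1; exact: hU.
Qed.

(** Real-valued, so that squared overlaps of eigenvectors can serve as probability weights in
    [R]. *)
Definition sqnorm (z : C) : R := complex.Re z ^+ 2 + complex.Im z ^+ 2.

Lemma mulcconj (z : C) : z * Num.conj z = (sqnorm z)%:C%C.
Proof. by rewrite -normCK -add_Re2_Im2. Qed.

Lemma sqnorm_ge0 z : 0 <= sqnorm z.
Proof. by rewrite addr_ge0 // sqr_ge0. Qed.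

Lemma sqnorm_conj z : sqnorm (Num.conj z) = sqnorm z.
Proof. by case: z => a b; rewrite /sqnorm /= sqrrN. Qed.

Lemma sqnorm_eq0 z : sqnorm z = 0 -> z = 0.
Proof.
move=> h; apply/eqP; have : z * Num.conj z = 0 by rewrite mulcconj h.
by move/eqP; rewrite mulf_eq0 conjC_eq0 orbb.
Qed.

Lemma sqnorm_add_le z w : sqnorm (z + w) <= 2 * (sqnorm z + sqnorm w).
Proof.
case: z w => [a b] [c e]; rewrite /sqnorm /=.
have := sqr_ge0 (a - c); have := sqr_ge0 (b - e); lra.
Qed.

Lemma ReD (z w : C) : complex.Re (z + w) = complex.Re z + complex.Re w.
Proof. by case: z w => [a b] []. Qed.

Lemma ImD (z w : C) : complex.Im (z + w) = complex.Im z + complex.Im w.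
Proof. by case: z w => [a b] []. Qed.

Lemma ReN (z : C) : complex.Re (- z) = - complex.Re z.
Proof. by case: z. Qed.

Lemma Re_sum (I : Type) (s : seq I) (P : pred I) (F : I -> C) :
  complex.Re (\sum_(i <- s | P i) F i) = \sum_(i <- s | P i) complex.Re (F i).
Proof. exact: (big_morph _ ReD). Qed.

Lemma Re_realM (x : R) (z : C) : complex.Re (x%:C%C * z) = x * complex.Re z.
Proof. by case: z => a b /=; rewrite mul0r subr0. Qed.

Lemma row_mul_adj m n (A : 'M[C]_(m, n)) i :
  (A *m adj A) i i = (\sum_j sqnorm (A i j))%:C%C.
Proof. by rewrite mxE rmorph_sum; apply: eq_bigr => j _; rewrite adjE mulcconj. Qed.

Lemma mul_adj_eq0 m n (A : 'M[C]_(m, n)) : A *m adj A = 0 -> A = 0.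
Proof.
move=> h; apply/matrixP => i j; rewrite mxE; apply: sqnorm_eq0.
have : \sum_j sqnorm (A i j) = 0.
  by apply: (@complexI R); rewrite -row_mul_adj h mxE.
move/eqP; rewrite psumr_eq0 => [/allP/(_ j)|k _]; last exact: sqnorm_ge0.
by rewrite mem_index_enum => /(_ isT)/eqP.
Qed.

Lemma trace_mul_adj_ge0 m n (A : 'M[C]_(m, n)) : 0 <= complex.Re (\tr (A *m adj A)).
Proof.
rewrite /mxtrace Re_sum sumr_ge0 // => i _.
by rewrite row_mul_adj /= sumr_ge0 // => j _; apply: sqnorm_ge0.
Qed.

End Adjoint.

(** * Spectral form, positivity and functions of Hermitian matrices *)

Section Spectral.
Variable R : realType.
Local Notation C := R[i].
Variable m : nat.
Implicit Types (U V A B : 'M[C]_m) (p q : 'I_m -> R).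

Definition dmx p : 'M[C]_m := diag_mx (\row_i (p i)%:C%C).

(** For unitary [U] the rows of [U] are the adjoints of the eigenvectors, so the entries of
    [U *m adj V] are the overlaps of two eigenbases. *)
Definition spec U p : 'M[C]_m := adj U *m dmx p *m U.

Lemma dmxE p i j : dmx p i j = ((p i)%:C%C *+ (i == j)).
Proof. by rewrite !mxE; case: eqP => // ->. Qed.

Lemma mul_dmx_mx n p (A : 'M[C]_(m, n)) i j : (dmx p *m A) i j = (p i)%:C%C * A i j.
Proof. by rewrite /dmx mul_diag_mx !mxE. Qed.

Lemma mul_mx_dmx n p (A : 'M[C]_(n, m)) i j : (A *m dmx p) i j = A i j * (p j)%:C%C.
Proof. by rewrite /dmx mul_mx_diag !mxE. Qed.

Lemma adj_dmx p : adj (dmx p) = dmx p.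
Proof.
apply/matrixP => i j; rewrite adjE !dmxE eq_sym; case: eqP => [->|_] /=.
  by rewrite !mulr1n; apply: conjc_real.
by rewrite !mulr0n rmorph0.
Qed.

Lemma mul_dmx p q : dmx p *m dmx q = dmx (fun i => p i * q i).
Proof. by apply/matrixP => i j; rewrite mul_dmx_mx !dmxE mulrnAr -rmorphM. Qed.

Lemma dmx1 : dmx (fun=> 1) = 1%:M.
Proof. by apply/matrixP => i j; rewrite dmxE mxE. Qed.

Lemma eq_spec U p q : p =1 q -> spec U p = spec U q.
Proof. by move=> h; congr (_ *m _ *m _); apply/matrixP => i j; rewrite !dmxE h. Qed.

Lemma adj_spec U p : adj (spec U p) = spec U p.
Proof. by rewrite /spec !adjM adjK adj_dmx mulmxA. Qed.

Lemma mul_spec U p q : unitary U ->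
  spec U p *m spec U q = spec U (fun i => p i * q i).
Proof.
move=> hU; rewrite /spec -!mulmxA (mulmxA U) hU mul1mx.
by rewrite (mulmxA (dmx p)) mul_dmx.
Qed.

Lemma spec1 U : unitary U -> spec U (fun=> 1) = 1%:M.
Proof. by move=> hU; rewrite /spec dmx1 mulmx1 unitaryV. Qed.

Lemma specB U p q : spec U (fun i => p i - q i) = spec U p - spec U q.
Proof.
rewrite /spec -mulmxBl -mulmxBr; congr (_ *m _ *m _).
by apply/matrixP => i j; rewrite dmxE [RHS]mxE [(- dmx q) i j]mxE !dmxE rmorphB mulrnBl.
Qed.

Lemma spec_conj V U p i :
  (V *m spec U p *m adj V) i i = (\sum_k p k * sqnorm ((U *m adj V) k i))%:C%C.
Proof.
have -> : V *m spec U p *m adj V = adj (U *m adj V) *m (dmx p *m (U *m adj V)).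
  by rewrite adjM adjK /spec !mulmxA.
rewrite mxE rmorph_sum; apply: eq_bigr => k _.
by rewrite mul_dmx_mx adjE mulrCA (mulrC (Num.conj _)) mulcconj -rmorphM.
Qed.

Lemma trace_spec U p : unitary U -> \tr (spec U p) = (\sum_i p i)%:C%C.
Proof.
move=> hU; rewrite /spec -mulmxA mxtrace_mulC -mulmxA hU mulmx1 mxtrace_diag.
by rewrite rmorph_sum; apply: eq_bigr => i _; rewrite mxE.
Qed.

Lemma trace_mul_spec V q A : unitary V ->
  \tr (A *m spec V q) = \sum_j (q j)%:C%C * (V *m A *m adj V) j j.
Proof.
move=> hV; rewrite /spec !mulmxA mxtrace_mulC !mulmxA.
by apply: eq_bigr => i _; rewrite mul_mx_dmx mulrC.
Qed.

Lemma trace_spec_spec U p V q : unitary V ->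
  \tr (spec U p *m spec V q) =
  (\sum_i \sum_j p i * q j * sqnorm ((U *m adj V) i j))%:C%C.
Proof.
move=> hV; rewrite trace_mul_spec // exchange_big rmorph_sum.
apply: eq_bigr => j _; rewrite spec_conj -rmorphM mulr_sumr; congr (_%:C)%C.
by apply: eq_bigr => i _; rewrite mulrCA mulrA.
Qed.

Lemma unitary_sqnorm_row (W : 'M[C]_m) i : unitary W -> \sum_j sqnorm (W i j) = 1.
Proof. by move=> hW; apply: (@complexI R); rewrite -row_mul_adj hW mxE eqxx. Qed.

Lemma unitary_sqnorm_col (W : 'M[C]_m) j : unitary W -> \sum_i sqnorm (W i j) = 1.
Proof.
move=> /unitary_adj/(unitary_sqnorm_row j) <-; apply: eq_bigr => i _.
by rewrite adjE sqnorm_conj.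
Qed.

(** One eigenbasis serves every function [f], so that a matrix, its support and its logarithm are
    diagonalised together. *)
Lemma hermitian_spec A : adj A = A -> exists U p,
  [/\ unitary U, A = spec U p & forall f, mx_fun f A = spec U (f \o p)].
Proof.
move=> hA.
have hH : A \is hermsymmx.
  by apply/is_hermitianmxP; rewrite expr0 scale1r; rewrite -{1}hA /adj map_trmx.
have hn := hermitian_normalmx hH.
have hU : unitary (spectralmx A).
  by have /unitarymxP := spectral_unitarymx A; rewrite /unitary /adj map_trmx.
have hi : invmx (spectralmx A) = adj (spectralmx A).
  by rewrite (invmx_unitary (spectral_unitarymx A)) /adj map_trmx.
exists (spectralmx A), (fun i => complex.Re (spectral_diag A 0 i)).
split; first exact: hU.
  rewrite /spec -hi {1}(orthomx_spectralP hn); congr (_ *m _ *m _).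
  rewrite /dmx; congr diag_mx; apply/rowP => i; rewrite mxE.
  by rewrite RRe_real //; have /mxOverP/(_ 0 i) := hermitian_spectral_diag_real hH.
move=> f; rewrite /mx_fun /spec -hi; congr (_ *m _ *m _).
by rewrite /dmx; congr diag_mx; apply/rowP => i; rewrite !mxE.
Qed.

Lemma spec_quad U p (v : 'rV[C]_m) :
  (v *m spec U p *m adj v) 0 0 = (\sum_k p k * sqnorm ((v *m adj U) 0 k))%:C%C.
Proof.
have -> : v *m spec U p *m adj v = v *m adj U *m dmx p *m adj (v *m adj U).
  by rewrite adjM adjK /spec !mulmxA.
rewrite mxE rmorph_sum; apply: eq_bigr => k _.
by rewrite mul_mx_dmx adjE mulrAC mulcconj mulrC -rmorphM.
Qed.

Lemma psd_spec U p : (forall i, 0 <= p i) -> psd (spec U p).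
Proof.
move=> hp; split=> [|v]; first exact: adj_spec.
by rewrite spec_quad ler0c sumr_ge0 // => k _; rewrite mulr_ge0 ?sqnorm_ge0.
Qed.

Lemma psd_spec_ge0 U p : unitary U -> psd (spec U p) -> forall i, 0 <= p i.
Proof.
move=> hU [_ h] i; have := h (row i U); rewrite spec_quad ler0c -row_mul hU.
rewrite (bigD1 i) //= big1 ?addr0 => [|k /negPf hk].
  by rewrite !mxE eqxx /sqnorm /= expr0n /= addr0 expr1n mulr1.
by rewrite !mxE eq_sym hk /sqnorm /= expr0n /= addr0 mulr0.
Qed.

Lemma psdP A : psd A -> exists U p,
  [/\ unitary U, A = spec U p, forall i, 0 <= p i & forall f, mx_fun f A = spec U (f \o p)].
Proof.
move=> hA; have [U [p [hU eA hf]]] := hermitian_spec hA.1.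
exists U, p; split=> //; apply: psd_spec_ge0 (hU) _; by rewrite -eA.
Qed.

Lemma psd_gram n (X : 'M[C]_(m, n)) : psd (X *m adj X).
Proof.
split=> [|v]; first by rewrite adjM adjK.
rewrite -!mulmxA (mulmxA v) -adjM row_mul_adj ler0c sumr_ge0 // => j _.
exact: sqnorm_ge0.
Qed.

Lemma psd_sqrt A : psd A -> exists X : 'M[C]_m, A = X *m adj X.
Proof.
move=> /psdP[U [p [hU -> hp _]]]; exists (spec U (fun i => Num.sqrt (p i))).
by rewrite adj_spec mul_spec //; apply: eq_spec => i; rewrite -expr2 sqr_sqrtr.
Qed.

Lemma trace_psd_ge0 A B : psd A -> psd B -> 0 <= complex.Re (\tr (A *m B)).
Proof.
move=> /psd_sqrt[X ->] /psd_sqrt[Y ->].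
rewrite mulmxA mxtrace_mulC.
have -> : adj Y *m (X *m adj X *m Y) = adj Y *m X *m adj (adj Y *m X).
  by rewrite adjM adjK !mulmxA.
exact: trace_mul_adj_ge0.
Qed.

(* Commutation with a Hermitian matrix is entrywise vanishing between distinct
   eigenvalues, hence passes to functions of it. *)
Lemma spec_comm U p (f : R -> R) X : unitary U ->
  X *m spec U p = spec U p *m X -> X *m spec U (f \o p) = spec U (f \o p) *m X.
Proof.
move=> hU h.
have red q : X *m spec U q = spec U q *m X <->
    (U *m X *m adj U) *m dmx q = dmx q *m (U *m X *m adj U).
  split=> [e|e].
    have /(congr1 (fun M => U *m M *m adj U)) := e.
    rewrite /spec !mulmxA hU mul1mx => e'.
    have := e'; rewrite -[in X in X = _ -> _](mulmxA _ U (adj U)) hU mulmx1 => ->.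
    by rewrite -!mulmxA.
  have := congr1 (fun M => adj U *m M *m U) e.
  rewrite /spec !mulmxA (unitaryV hU) mul1mx => ->.
  by rewrite -!mulmxA (unitaryV hU) mulmx1.
apply/red/matrixP => i j; move/red: h => /matrixP/(_ i j).
rewrite !mul_mx_dmx !mul_dmx_mx /= => e.
have [<-|hn] := eqVneq (p i) (p j); first by rewrite mulrC.
suff -> : (U *m X *m adj U) i j = 0 by rewrite mulr0 mul0r.
apply/eqP; move/eqP: e; rewrite mulrC -subr_eq0 -mulrBl -rmorphB mulf_eq0.
by case/orP=> // /eqP /(@complexI R)/eqP; rewrite subr_eq0 eq_sym (negPf hn).
Qed.

Lemma psd_proj (P : 'M[C]_m) : adj P = P -> P *m P = P -> psd P.
Proof. by move=> hP hPP; rewrite -hPP -{2}hP; apply: psd_gram. Qed.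

Lemma retrB A B : complex.Re (\tr (A - B)) = complex.Re (\tr A) - complex.Re (\tr B).
Proof. by rewrite mxtraceD ReD (linearN (@mxtrace _ m)) ReN. Qed.

(** The diagonal entry of [Y *m Y] at an eigenvector is the squared norm of a row of [U *m Y], which
    may be expanded in any other basis [V]. *)
Lemma trace_spec_gram U p V Y : unitary U -> unitary V -> adj Y = Y ->
  complex.Re (\tr (spec U p *m (Y *m Y))) =
  \sum_i \sum_j p i * sqnorm ((U *m Y *m adj V) i j).
Proof.
move=> hU hV hY; rewrite mxtrace_mulC trace_mul_spec // Re_sum.
apply: eq_bigr => i _; rewrite Re_realM -mulr_sumr; congr (_ * _).
have -> : U *m (Y *m Y) *m adj U = (U *m Y *m adj V) *m adj (U *m Y *m adj V).
  by rewrite !adjM adjK hY !mulmxA -(mulmxA _ (adj V) V) (unitaryV hV) mulmx1.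
by rewrite row_mul_adj.
Qed.

(** On eigenvalues this is [0 <= t - t ^+ 2] for [0 <= t <= 1]. *)
Lemma effect_sub_sqr (T : 'M[C]_m) : psd T -> psd (1%:M - T) -> psd (T - T *m T).
Proof.
move=> /psdP[W [t [hW -> ht _]]]; rewrite -(spec1 hW) -specB => /(psd_spec_ge0 hW) ht1.
rewrite mul_spec // -specB; apply: psd_spec => i; have := ht1 i; have := ht i; nra.
Qed.

End Spectral.

(** * Relative entropy in two eigenbases and lower bounds on test errors *)

Section RelativeEntropy.
Variable R : realType.
Local Notation C := R[i].
Variable m : nat.
Implicit Types (rho sigma T : 'M[C]_m).

Definition lnz (x : R) : R := if 0 < x then ln x else 0.

Lemma lnz_gt0 x : 0 < x -> lnz x = ln x.
Proof. by rewrite /lnz => ->. Qed.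

(** Evaluated at a kernel vector of the second matrix, the inequality of supports makes a sum of
    nonnegative overlaps nonpositive. *)
Lemma supp_overlap (U : 'M[C]_m) p V q : unitary U -> unitary V ->
  loewner_le (spec U ((fun x : R => if x == 0 then 0 else 1) \o p))
             (spec V ((fun x : R => if x == 0 then 0 else 1) \o q)) ->
  forall i j, p i != 0 -> q j = 0 -> sqnorm ((U *m adj V) i j) = 0.
Proof.
move=> hU hV [_ h] i j hp hq; have := h (row j V).
rewrite mulmxBr mulmxBl mxE [X in _ + X]mxE !spec_quad -rmorphB ler0c.
rewrite big1 => [|k _]; last first.
  rewrite -row_mul hV !mxE /=; case: (eqVneq j k) => [<-|_].
    by rewrite hq eqxx mul0r.
  by rewrite /sqnorm /= expr0n addr0 mulr0.
rewrite sub0r oppr_ge0 (bigD1 i) //= (negPf hp) mul1r => hle.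
have hs : sqnorm ((U *m adj V) i j) = sqnorm ((row j V *m adj U) 0 i).
  rewrite (_ : U *m adj V = adj (V *m adj U)); last by rewrite adjM adjK.
  by rewrite adjE sqnorm_conj -row_mul [in RHS]mxE.
apply/eqP; rewrite eq_le sqnorm_ge0 andbT hs; apply: le_trans hle.
rewrite lerDl sumr_ge0 // => k _; rewrite mulr_ge0 ?sqnorm_ge0 //.
by case: eqP.
Qed.

(** With [w i j] the squared overlap, this is the classical relative entropy of the pair
    [p i * w i j] and [q j * w i j]; the vanishing overlaps give its absolute continuity. *)
Lemma relentP rho sigma : psd rho -> psd sigma -> loewner_le (supp rho) (supp sigma) ->
  exists U p V q, [/\ unitary U, unitary V, rho = spec U p, sigma = spec V q &
    [/\ forall i, 0 <= p i, forall j, 0 <= q j,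
      forall i j, p i != 0 -> q j = 0 -> sqnorm ((U *m adj V) i j) = 0 &
      relent rho sigma = (\sum_i \sum_j
        sqnorm ((U *m adj V) i j) * (p i * (lnz (p i) - lnz (q j))))%:E]].
Proof.
move=> /psdP[U [p [hU er hp fr]]] /psdP[V [q [hV es hq fs]]] hle.
exists U, p, V, q; split=> //; split=> //.
  by move: hle; rewrite /supp fr fs; apply: supp_overlap.
rewrite /relent; case: asboolP => // _; congr (_%:E).
rewrite /mlog fr fs mulmxBr retrB {1}er mul_spec // trace_spec // {1}er.
rewrite trace_spec_spec //= -sumrB; apply: eq_bigr => i _.
(* The squared overlaps in a row sum to 1, which spreads the entropy term of [rho] over [j]. *)
rewrite -[X in X - _]mulr1 -(unitary_sqnorm_row i (unitary_mul hU (unitary_adj hV))).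
by rewrite mulr_sumr -sumrB; apply: eq_bigr => j _; rewrite /lnz; ring.
Qed.

(** From [ln (q / p) <= q / p - 1]. Adding [q] makes each term nonnegative, as the Markov argument
    below requires; these additions sum to 1. *)
Lemma entropy_term_ge (w p q : R) : 0 <= w -> 0 <= p -> 0 <= q ->
  (p != 0 -> q = 0 -> w = 0) -> 0 <= w * (p * (lnz p - lnz q) + q).
Proof.
move=> hw hp hq h; have [->|hp0] := eqVneq p 0; first by rewrite mul0r add0r mulr_ge0.
have [q0|hq0] := eqVneq q 0; first by rewrite h // mul0r.
have hpp : 0 < p by rewrite lt_neqAle eq_sym hp0.
have hqq : 0 < q by rewrite lt_neqAle eq_sym hq0.
rewrite mulr_ge0 // !lnz_gt0 //.
have : ln (q / p) <= q / p - 1.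
  rewrite -[X in ln X](subrKC 1); apply: le_ln1Dx.
  by rewrite ltrBrDl addrN divr_gt0.
rewrite ln_div ?posrE // => hln; have := ler_wpM2l hp hln.
have -> : p * (q / p - 1) = q - p by field.
lra.
Qed.

(** Markov's inequality term by term: if [p <= expR a * q] the minimum is [p] and a nonnegative
    quantity is subtracted; otherwise the log-likelihood ratio is at least [a] and the left side is
    nonpositive. *)
Lemma min_term_ge (w p q a : R) : 0 <= w -> 0 <= p -> 0 <= q -> 0 < a ->
  (p != 0 -> q = 0 -> w = 0) ->
  w * p - a^-1 * (w * (p * (lnz p - lnz q) + q)) <= Num.min p (expR a * q) * w.
Proof.
move=> hw hp hq ha h; have hpos := entropy_term_ge hw hp hq h.
have hinv : 0 <= a^-1 by rewrite invr_ge0 ltW.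
have hai := mulr_ge0 hinv hpos.
have [hle|hlt] := leP p (expR a * q).
  rewrite mulrC; lra.
have [w0|w0] := eqVneq w 0; first by rewrite w0 !mul0r !mulr0 subrr.
have hpp : 0 < p by apply: le_lt_trans hlt; rewrite mulr_ge0 ?expR_ge0.
have hqq : 0 < q.
  rewrite lt_neqAle hq andbT eq_sym; apply/eqP => q0.
  by rewrite h ?eqxx ?gt_eqF // in w0.
have hl : a <= lnz p - lnz q.
  rewrite !lnz_gt0 // -[X in X <= _](expRK a) -ln_div ?posrE //.
  rewrite ler_ln ?posrE ?expR_gt0 ?divr_gt0 //.
  by rewrite ler_pdivlMr // ltW.
have : w * p <= a^-1 * (w * (p * (lnz p - lnz q) + q)).
  rewrite ler_pdivlMl // mulrC -mulrA ler_wpM2l // (le_trans (ler_wpM2l hp hl)) //.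
  by rewrite lerDl.
move=> h1; apply: (@le_trans _ _ 0); first by rewrite subr_le0.
by rewrite !mulr_ge0 ?expR_ge0.
Qed.

(* The Nussbaum-Szkola comparison with the pair of classical distributions
   [p i * |<u_i, v_j>|^2] and [q j * |<u_i, v_j>|^2]. *)
Lemma test_lower_bound (U : 'M[C]_m) p V q T s : unitary U -> unitary V ->
  (forall i, 0 <= p i) -> (forall j, 0 <= q j) -> 0 <= s ->
  psd T -> psd (1%:M - T) ->
  \sum_i \sum_j Num.min (p i) (s * q j) * sqnorm ((U *m adj V) i j) <=
  2 * (complex.Re (\tr (spec U p *m (1%:M - T))) + s * complex.Re (\tr (spec V q *m T))).
Proof.
move=> hU hV hp hq hs hT hT1; set T' := 1%:M - T.
have hT' : psd (1%:M - T') by rewrite /T' opprB addrC subrK.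
(* Replacing an effect by its smaller square turns both errors into sums of squared matrix
   entries. *)
have h1 : complex.Re (\tr (spec U p *m (T' *m T'))) <= complex.Re (\tr (spec U p *m T')).
  rewrite -subr_ge0 -retrB -mulmxBr; apply: trace_psd_ge0; first exact: psd_spec.
  exact: effect_sub_sqr.
have h2 : complex.Re (\tr (spec V q *m (T *m T))) <= complex.Re (\tr (spec V q *m T)).
  rewrite -subr_ge0 -retrB -mulmxBr; apply: trace_psd_ge0; first exact: psd_spec.
  exact: effect_sub_sqr.
apply: (@le_trans _ _ (2 * (complex.Re (\tr (spec U p *m (T' *m T'))) +
                            s * complex.Re (\tr (spec V q *m (T *m T)))))); last first.
  by rewrite ler_pM2l // lerD // ler_wpM2l.
rewrite (trace_spec_gram p hU hV hT1.1) (trace_spec_gram q hV hU hT.1).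
rewrite [X in s * X]exchange_big mulr_sumr -big_split mulr_sumr ler_sum //= => i _.
rewrite mulr_sumr -big_split mulr_sumr ler_sum //= => j _.
have -> : sqnorm ((V *m T *m adj U) j i) = sqnorm ((U *m T *m adj V) i j).
  by rewrite -sqnorm_conj -adjE !adjM adjK hT.1 !mulmxA.
(* Inserting [T' + T = 1] splits each overlap in two; the factor 2 comes from bounding the squared
   modulus of the sum. *)
have -> : U *m adj V = U *m T' *m adj V + U *m T *m adj V.
  by rewrite -mulmxDl -mulmxDr subrK mulmx1.
rewrite [X in sqnorm X]mxE.
set z := (U *m T' *m adj V) i j; set w := (U *m T *m adj V) i j.
have hz := sqnorm_add_le z w; have h3 := sqnorm_ge0 z; have h4 := sqnorm_ge0 w.
have hm1 : Num.min (p i) (s * q j) <= p i by rewrite ge_min lexx.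
have hm2 : Num.min (p i) (s * q j) <= s * q j by rewrite ge_min lexx orbT.
have hm0 : 0 <= Num.min (p i) (s * q j) by rewrite le_min hp mulr_ge0.
apply: (le_trans (ler_wpM2l hm0 hz)).
have := ler_wpM2r h3 hm1; have := ler_wpM2r h4 hm2; lra.
Qed.

Lemma trace_density_spec (U : 'M[C]_m) p : unitary U -> \tr (spec U p) = 1 -> \sum_i p i = 1.
Proof. by move=> hU; rewrite trace_spec // => /(@complexI R). Qed.

(** Summing [min_term_ge] bounds the sum of minima from below. Here [expR a] is the likelihood
    threshold, and the 1 added to the relative entropy is the total mass of the second
    distribution. *)
Lemma relent_test_bound rho sigma T (a : R) : density rho -> density sigma ->
  loewner_le (supp rho) (supp sigma) -> psd T -> psd (1%:M - T) -> 0 < a ->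
  1 - a^-1 * (1 + fine (relent rho sigma)) <=
  2 * (complex.Re (\tr (rho *m (1%:M - T))) + expR a * complex.Re (\tr (sigma *m T))).
Proof.
move=> [hr tr1] [hs ts1] hle hT hT1 ha.
have [U [p [V [q [hU hV er es [hp hq hW ->]]]]]] := relentP hr hs hle.
have hUV := unitary_mul hU (unitary_adj hV).
have sq : \sum_i \sum_j sqnorm ((U *m adj V) i j) * q j = 1.
  rewrite es in ts1; rewrite -(trace_density_spec hV ts1) exchange_big; apply: eq_bigr => i _.
  by rewrite -mulr_suml unitary_sqnorm_col // mul1r.
rewrite -[X in _ * (X + _)]sq.
rewrite er es; apply: le_trans (test_lower_bound hU hV hp hq (expR_ge0 a) hT hT1).
have <- : \sum_i \sum_j sqnorm ((U *m adj V) i j) * p i = 1 :> R.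
  rewrite er in tr1; rewrite -(trace_density_spec hU tr1); apply: eq_bigr => i _.
  by rewrite -mulr_suml unitary_sqnorm_row // mul1r.
rewrite -big_split mulr_sumr -sumrB ler_sum //= => i _.
rewrite -big_split mulr_sumr -sumrB ler_sum //= => j _.
rewrite -mulrDr (addrC (q j)); apply: min_term_ge => //; [exact: sqnorm_ge0|exact: hW].
Qed.

(** The terms of [entropy_term_ge] sum to the relative entropy plus 1. This constant disappears
    after division by [n]. *)
Lemma relent_ge rho sigma : density rho -> density sigma ->
  loewner_le (supp rho) (supp sigma) -> -1 <= fine (relent rho sigma).
Proof.
move=> [hr _] [hs ts1] hle.
have [U [p [V [q [hU hV er es [hp hq hW ->]]]]]] := relentP hr hs hle.
have hUV := unitary_mul hU (unitary_adj hV).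
have <- : \sum_i \sum_j sqnorm ((U *m adj V) i j) * q j = 1.
  rewrite es in ts1; rewrite -(trace_density_spec hV ts1) exchange_big; apply: eq_bigr => i _.
  by rewrite -mulr_suml unitary_sqnorm_col // mul1r.
rewrite lerNl -subr_ge0 opprK addrC /= -big_split sumr_ge0 //= => i _.
rewrite -big_split sumr_ge0 //= => j _.
rewrite -mulrDr entropy_term_ge //; [exact: sqnorm_ge0|exact: hW].
Qed.

Lemma relent_fin rho sigma : loewner_le (supp rho) (supp sigma) ->
  relent rho sigma = (fine (relent rho sigma))%:E.
Proof. by rewrite /relent; case: asboolP. Qed.

End RelativeEntropy.

(** * The projective test built from two spectral projections *)

Section RangeTest.
Variable R : realType.
Local Notation C := R[i].
Variable m : nat.

(** [T] is the support projection and [B] the pseudo-inverse, by the convention that the inverse of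
    0 is 0. As [T] is a function of [A], it commutes with whatever commutes with [A]. *)
Lemma hermitian_supp (A : 'M[C]_m) : adj A = A -> exists T B : 'M[C]_m,
  [/\ adj T = T, adj B = B, T *m T = T, T *m A = A &
  [/\ A *m B = T, B *m T = B & forall X, X *m A = A *m X -> X *m T = T *m X]].
Proof.
move=> aA; have [W [a [hW eA _]]] := hermitian_spec aA.
pose f (x : R) : R := (x != 0)%R%:R.
exists (spec W (f \o a)), (spec W ((fun x => x^-1) \o a)).
split; [exact: adj_spec|exact: adj_spec| | |split].
- by rewrite mul_spec //; apply: eq_spec => i; rewrite /= /f -natrM mulnb andbb.
- rewrite eA mul_spec //; apply: eq_spec => i; rewrite /= /f.
  by case: eqP => [->|_]; rewrite ?mulr0 ?mul1r.
- rewrite eA mul_spec //; apply: eq_spec => i; rewrite /= /f.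
  by case: eqP => [->|/eqP h]; rewrite ?mul0r ?divff.
- rewrite mul_spec //; apply: eq_spec => i; rewrite /= /f.
  by case: eqP => [->|/eqP h]; rewrite ?mulr0 ?invr0 ?mulr1.
- by move=> X; rewrite eA; apply: spec_comm.
Qed.

Lemma psd_compl_proj (P : 'M[C]_m) : adj P = P -> P *m P = P -> psd (1%:M - P).
Proof.
move=> aP PP; apply: psd_proj; first by rewrite adjB adj_mx1 aP.
by rewrite mulmxBr mulmx1 mulmxBl mul1mx PP subrr subr0.
Qed.

(* [T] is the projection onto the range of [Q P]. *)
Lemma range_proj (P Q : 'M[C]_m) : adj P = P -> P *m P = P -> adj Q = Q -> Q *m Q = Q ->
  exists T : 'M[C]_m, [/\ adj T = T, T *m T = T,
    forall X, X *m P = P *m X -> X *m Q = Q *m X -> X *m T = T *m X,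
    Q *m T = T & T *m Q *m P = Q *m P /\ complex.Re (\tr T) <= complex.Re (\tr P)].
Proof.
move=> aP PP aQ QQ; pose A := Q *m P *m Q.
have aA : adj A = A by rewrite /A !adjM aP aQ mulmxA.
have [T [B [aT aB TT TA [AB BT cT]]]] := hermitian_supp aA.
have QT : Q *m T = T by rewrite -AB mulmxA /A !mulmxA QQ.
exists T; split=> //; [|split].
- move=> X hXP hXQ; apply: cT; rewrite /A !mulmxA hXQ -(mulmxA Q X P) hXP.
  by rewrite !mulmxA -(mulmxA _ X Q) hXQ !mulmxA.
(* [Y = (1 - T) Q P] vanishes because [Y *m adj Y] is [(1 - T) A (1 - T)] and [T A = A]. *)
- apply/eqP; rewrite eq_sym -subr_eq0; apply/eqP/mul_adj_eq0.
  have aM : adj ((1%:M - T) *m (Q *m P)) = P *m Q *m (1%:M - T).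
    by rewrite !adjM adjB adj_mx1 aP aQ aT.
  rewrite (_ : Q *m P - T *m Q *m P = (1%:M - T) *m (Q *m P)); last first.
    by rewrite mulmxBl mul1mx mulmxA.
  rewrite aM !mulmxA -(mulmxA _ P P) PP -(mulmxA _ Q P) -(mulmxA _ (Q *m P)) -/A.
  by rewrite mulmxBl mul1mx TA subrr mul0mx.
(* [Pi] projects onto the range of [P Q]: it has the same trace as [T], by cyclicity, and lies below
   [P]. *)
pose Pi := P *m Q *m B *m Q *m P.
have aPi : adj Pi = Pi by rewrite /Pi !adjM aP aQ aB !mulmxA.
have PiPi : Pi *m Pi = Pi.
  have -> : Pi *m Pi = P *m Q *m (B *m (Q *m (P *m P) *m Q *m B)) *m Q *m P.
    by rewrite /Pi !mulmxA.
  by rewrite PP AB BT.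
have eT : \tr T = \tr Pi.
  rewrite /Pi mxtrace_mulC !mulmxA PP -AB /A.
  by rewrite -[RHS]mxtrace_mulC !mulmxA.
have PPi : P *m Pi = Pi by rewrite /Pi !mulmxA PP.
rewrite eT -subr_ge0 -retrB -{1}[P]mulmx1 -PPi -mulmxBr; apply: trace_psd_ge0.
  exact: psd_proj.
exact: psd_compl_proj.
Qed.

Lemma spec_indic (U : 'M[C]_m) (b : 'I_m -> bool) : unitary U ->
  spec U (fun i => (b i)%:R) *m spec U (fun i => (b i)%:R) = spec U (fun i => (b i)%:R).
Proof. by move=> hU; rewrite mul_spec //; apply: eq_spec => i; rewrite -natrM mulnb andbb. Qed.

Lemma spec_cst (V : 'M[C]_m) (t : R) : unitary V -> spec V (fun=> t) = t%:C%C *: 1%:M.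
Proof.
move=> hV; rewrite -(spec1 hV) /spec scalemxAl scalemxAr; congr (_ *m _ *m _).
by apply/matrixP => i j; rewrite dmx1 dmxE !mxE mulr_natr.
Qed.

(** Let [P] keep the eigenvalues [p i >= c] and [Q] the eigenvalues [q j <= t]. In the first error
    [1 - Q] gives the tail in [q], while [Q - T] is orthogonal to [P] and gives the tail in [p]. The
    second error is at most [t * \tr T], and [\tr T <= \tr P] is at most the sum of the
    [p i / c]. *)
Lemma range_test (U : 'M[C]_m) (p : 'I_m -> R) V (q : 'I_m -> R) (c t : R) :
  unitary U -> unitary V -> (forall i, 0 <= p i) -> (forall j, 0 <= q j) ->
  0 < c -> 0 <= t ->
  exists T : 'M[C]_m, [/\ adj T = T, T *m T = T,
    forall X, X *m spec U p = spec U p *m X -> X *m spec V q = spec V q *m X ->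
      X *m T = T *m X,
    complex.Re (\tr (spec U p *m (1%:M - T))) <=
      \sum_(i | p i < c) p i +
      \sum_(j | t < q j) \sum_i p i * sqnorm ((U *m adj V) i j) &
    complex.Re (\tr (spec V q *m T)) <= t / c * \sum_i p i].
Proof.
move=> hU hV hp hq hc ht.
pose chi i : R := (c <= p i)%R%:R; pose psi j : R := (q j <= t)%R%:R.
have cP : forall X, X *m spec U p = spec U p *m X -> X *m spec U chi = spec U chi *m X.
  by move=> X; apply: (@spec_comm R m U p (fun x => (c <= x)%R%:R)).
have cQ : forall X, X *m spec V q = spec V q *m X -> X *m spec V psi = spec V psi *m X.
  by move=> X; apply: (@spec_comm R m V q (fun x => (x <= t)%R%:R)).
have [T [aT TT cT QT [TQP hTP]]] := range_proj (adj_spec U chi) (spec_indic _ hU)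
  (adj_spec V psi) (spec_indic _ hV).
exists T; split=> //; first by move=> X hX hY; apply: cT; [exact: cP|exact: cQ].
- have -> : 1%:M - T = (1%:M - spec V psi) + (spec V psi - T) by rewrite addrA subrK.
  rewrite mulmxDr mxtraceD ReD addrC; apply: lerD; last first.
    rewrite -(spec1 hV) -specB trace_spec_spec //= exchange_big [leRHS]big_mkcond /=.
    apply: ler_sum => j _; rewrite /psi; case: (leP (q j) t) => /= _.
      by rewrite big1 // => i _; rewrite subrr mulr0 mul0r.
    by apply: ler_sum => i _; rewrite subr0 mulr1.
  set F := spec V psi - T.
  have TQ : T *m spec V psi = T by rewrite -[LHS]adjK adjM adj_spec aT QT aT.
  have aF : adj F = F by rewrite adjB adj_spec aT.
  have FF : F *m F = F.
    by rewrite /F mulmxBr !mulmxBl spec_indic // TQ QT TT subrr subr0.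
  have FP : F *m spec U chi = 0 by rewrite /F mulmxBl -TQ TQP subrr.
  have PF : spec U chi *m F = 0 by rewrite -[LHS]adjK adjM aF adj_spec FP adj0.
  pose N := spec U (fun i => p i * (1 - chi i)).
  have eN : N = spec U p *m (1%:M - spec U chi) by rewrite -(spec1 hU) -specB mul_spec.
  have -> : spec U p *m F = N *m F.
    by rewrite eN -mulmxA mulmxBl mul1mx PF subr0.
  have hN : psd N.
    apply: psd_spec => i; rewrite /chi mulr_ge0 //.
    by case: (c <= p i); rewrite ?subrr ?subr0.
  have := trace_psd_ge0 hN (psd_compl_proj aF FF).
  rewrite mulmxBr mulmx1 retrB subr_ge0 => /le_trans; apply.
  rewrite trace_spec //= [leRHS]big_mkcond /= ler_sum // => i _.
  by rewrite /chi ltNge; case: (c <= p i); rewrite /= ?subrr ?mulr0 ?subr0 ?mulr1.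
have h1 : complex.Re (\tr (spec V q *m T)) <= t * complex.Re (\tr T).
  pose L := spec V (fun j => t - q j * psi j).
  have hL : psd L.
    apply: psd_spec => i; rewrite /psi; case: (leP (q i) t) => h.
      by rewrite mulr1 subr_ge0.
    by rewrite mulr0 subr0.
  have := trace_psd_ge0 hL (psd_proj aT TT).
  have -> : L = t%:C%C *: 1%:M - spec V q *m spec V psi by rewrite /L specB mul_spec // spec_cst.
  rewrite mulmxBl -scalemxAl mul1mx -mulmxA QT retrB mxtraceZ Re_realM subr_ge0.
  exact: id.
apply: (le_trans h1); rewrite -mulrA ler_wpM2l //.
rewrite (le_trans hTP) // trace_spec //= mulr_sumr ler_sum // => i _.
by rewrite /chi ler_pdivlMl //; case: (leP c (p i)) => h; rewrite ?mulr1 ?mulr0.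
Qed.

End RangeTest.


(** * Tensor powers and product weights *)

Section Tensor.
Variable R : realType.
Local Notation C := R[i].

Lemma adj_tens m n p q (A : 'M[C]_(m, n)) (B : 'M[C]_(p, q)) :
  adj (A *t B) = adj A *t adj B.
Proof. by rewrite /adj map_mxT trmx_tens. Qed.

Lemma tens1 m n : (1%:M : 'M[C]_m) *t (1%:M : 'M[C]_n) = 1%:M.
Proof.
apply/matrixP => i j; case: (mxtens_indexP i) => i0 i1; case: (mxtens_indexP j) => j0 j1.
rewrite tensmxE !mxE -natrM mulnb; congr (_%:R); congr nat_of_bool.
apply/andP/eqP => [[/eqP-> /eqP->] //|/(congr1 (@mxtens_unindex m n))].
by rewrite !mxtens_indexK => -[-> ->].
Qed.

Lemma sum_mxtens_index m n (F : 'I_(m * n) -> R) :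
  \sum_k F k = \sum_i \sum_j F (mxtens_index (i, j)).
Proof.
rewrite pair_big /= (reindex (@mxtens_index m n)) /=; last first.
  by exists (@mxtens_unindex m n) => k _; rewrite ?mxtens_indexK ?mxtens_unindexK.
by apply: eq_bigr => -[i j] _.
Qed.

Lemma trace_tens m n (A : 'M[C]_m) (B : 'M[C]_n) : \tr (A *t B) = \tr A * \tr B.
Proof.
rewrite /mxtrace big_distrlr /= pair_big /= (reindex (@mxtens_index m n)) /=; last first.
  by exists (@mxtens_unindex m n) => k _; rewrite ?mxtens_indexK ?mxtens_unindexK.
by apply: eq_bigr => -[i j] _; rewrite tensmxE.
Qed.

Lemma tens_suml m n p q (I : Type) (s : seq I) (c : I -> C) (A : I -> 'M[C]_(m, n))
    (B : 'M[C]_(p, q)) :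
  (\sum_(a <- s) c a *: A a) *t B = \sum_(a <- s) c a *: (A a *t B).
Proof.
apply/matrixP => i j; rewrite !mxE !summxE mulr_suml; apply: eq_bigr => a _.
by rewrite !mxE mulrA.
Qed.

Lemma tens_sumr m n p q (I : Type) (s : seq I) (c : I -> C) (A : I -> 'M[C]_(m, n))
    (B : 'M[C]_(p, q)) :
  B *t (\sum_(a <- s) c a *: A a) = \sum_(a <- s) c a *: (B *t A a).
Proof.
apply/matrixP => i j; rewrite !mxE !summxE mulr_sumr; apply: eq_bigr => a _.
by rewrite !mxE mulrCA.
Qed.

Section Product.
Variable D : nat.

(** The recursion follows the reduction of [D ^ k.+2] to [D * D ^ k.+1], so no casts occur. *)
Fixpoint ptens_rec (Y : nat -> 'M[C]_D) k : 'M[C]_(D ^ k.+1) :=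
  if k is k'.+1 then Y 0%N *t ptens_rec (fun i => Y i.+1) k' else Y 0%N.

Definition ptens (Y : nat -> 'M[C]_D) k : 'M[C]_(D ^ k) :=
  if k is k'.+1 then ptens_rec Y k' else 1%:M.

Lemma ptensSS Y k : ptens Y k.+2 = Y 0%N *t ptens (fun i => Y i.+1) k.+1.
Proof. by []. Qed.

Lemma tpowSS (A : 'M[C]_D) k : tpow A k.+2 = A *t tpow A k.+1.
Proof. by []. Qed.

Lemma tpowE (A : 'M[C]_D) k : tpow A k = ptens (fun=> A) k.
Proof. by case: k => // k; elim: k => // k IH; rewrite tpowSS IH. Qed.

Lemma eq_ptens Y Z k : (forall i, (i < k)%N -> Y i = Z i) -> ptens Y k = ptens Z k.
Proof.
case: k => // k; elim: k Y Z => [|k IH] Y Z h; first by rewrite /= h.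
by rewrite !ptensSS h // (IH _ (fun i => Z i.+1)) // => i hi; apply: h.
Qed.

Lemma ptens_mul Y Z k : ptens Y k *m ptens Z k = ptens (fun i => Y i *m Z i) k.
Proof.
case: k => [|k]; first by rewrite mulmx1.
by elim: k Y Z => // k IH Y Z; rewrite !ptensSS tensmx_mul IH.
Qed.

Lemma ptens1 k : ptens (fun=> 1%:M) k = 1%:M.
Proof. by case: k => // k; elim: k => // k IH; rewrite ptensSS IH tens1. Qed.

Lemma adj_ptens Y k : adj (ptens Y k) = ptens (fun i => adj (Y i)) k.
Proof.
case: k => [|k]; first by rewrite adj_mx1.
by elim: k Y => // k IH Y; rewrite !ptensSS adj_tens IH.
Qed.

Lemma tpow_mul (A B : 'M[C]_D) k : tpow (A *m B) k = tpow A k *m tpow B k.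
Proof. by rewrite !tpowE ptens_mul. Qed.

Lemma adj_tpow (A : 'M[C]_D) k : adj (tpow A k) = tpow (adj A) k.
Proof. by rewrite !tpowE adj_ptens. Qed.

Lemma tpow1 k : tpow (1%:M : 'M[C]_D) k = 1%:M.
Proof. by rewrite tpowE ptens1. Qed.

Lemma unitary_tpow (U : 'M[C]_D) k : unitary U -> unitary (tpow U k).
Proof. by move=> hU; rewrite /unitary adj_tpow -tpow_mul hU tpow1. Qed.

Lemma trace_tpow (A : 'M[C]_D) k : \tr (tpow A k) = \tr A ^+ k.
Proof.
case: k => [|k]; first by rewrite expr0; apply: mxtrace1.
by elim: k => // k IH; rewrite tpowSS trace_tens IH -exprS.
Qed.

Lemma psd_tpow (A : 'M[C]_D) k : psd A -> psd (tpow A k).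
Proof. by move=> /psd_sqrt[X ->]; rewrite tpow_mul -adj_tpow; apply: psd_gram. Qed.

Lemma density_tpow (A : 'M[C]_D) k : density A -> density (tpow A k).
Proof. by move=> [h t1]; split; [exact: psd_tpow|rewrite trace_tpow t1 expr1n]. Qed.

Definition upd (Z : nat -> 'M[C]_D) j A := fun i => if i == j then A else Z i.

(** Linearity in the factor [j], with coefficients displayed; it makes any trace against the product
    a linear form in that factor. *)
Lemma ptens_upd_delta Z j A k : (j < k)%N ->
  ptens (upd Z j A) k =
  \sum_(ab : 'I_D * 'I_D) A ab.1 ab.2 *: ptens (upd Z j (delta_mx ab.1 ab.2)) k.
Proof.
have eA : A = \sum_(ab : 'I_D * 'I_D) A ab.1 ab.2 *: delta_mx ab.1 ab.2.
  by rewrite {1}(matrix_sum_delta A) pair_big.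
case: k => // k; elim: k Z j => [|k IH] Z [|j] // hj.
  by rewrite ptensSS [upd Z 0 A 0%N]/= {1}eA tens_suml.
rewrite ptensSS [X in _ *t X](IH (fun i => Z i.+1)) // tens_sumr.
by apply: eq_bigr.
Qed.

(** An index of the tensor power is a word in ['I_D]; its weight is the product of the weights of
    its letters. *)
Fixpoint dvec_rec (f : 'I_D -> R) k : 'I_(D ^ k.+1) -> R :=
  if k is k'.+1 then
    fun x : 'I_(D * D ^ k'.+1) => f (mxtens_unindex x).1 * dvec_rec f (mxtens_unindex x).2
  else f.

Definition dvec (f : 'I_D -> R) k : 'I_(D ^ k) -> R :=
  if k is k'.+1 then dvec_rec f (k := k') else fun=> 1.
Arguments dvec f k x : clear implicits.

Lemma dvecSS f k (i : 'I_D) (j : 'I_(D ^ k.+1)) :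
  dvec f k.+2 (mxtens_index (i, j)) = f i * dvec f k.+1 j.
Proof.
have -> : forall x : 'I_(D * D ^ k.+1),
    dvec f k.+2 x = f (mxtens_unindex x).1 * dvec f k.+1 (mxtens_unindex x).2 by [].
by rewrite mxtens_indexK.
Qed.

Lemma dvecM f g k x : dvec (fun i => f i * g i) k x = dvec f k x * dvec g k x.
Proof.
case: k x => [|k] x; first by rewrite mulr1.
elim: k x => // k IH x; case: (mxtens_indexP x) => i j.
by rewrite !dvecSS IH mulrACA.
Qed.

Lemma sum_dvec f k : \sum_x dvec f k x = (\sum_i f i) ^+ k.
Proof.
case: k => [|k]; first by rewrite big_ord1.
elim: k => // k IH; rewrite (@sum_mxtens_index D (D ^ k.+1)) exprS -IH mulr_suml.
apply: eq_bigr => i _; rewrite mulr_sumr; apply: eq_bigr => j _; exact: dvecSS.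
Qed.

Lemma dvec_ge0 f k x : (forall i, 0 <= f i) -> 0 <= dvec f k x.
Proof.
move=> hf; case: k x => // k; elim: k => // k IH x; case: (mxtens_indexP x) => i j.
by rewrite dvecSS mulr_ge0.
Qed.

Lemma dvec_cst c k x : dvec (fun=> c) k x = c ^+ k.
Proof.
case: k x => // k; elim: k => // k IH x; case: (mxtens_indexP x) => i j.
by rewrite dvecSS IH -exprS.
Qed.

Lemma dvec_powR f s k x : (forall i, 0 <= f i) ->
  dvec (fun i => f i `^ s) k x = dvec f k x `^ s.
Proof.
move=> hf; case: k x => [|k] x; first by rewrite powR1.
elim: k x => // k IH x; case: (mxtens_indexP x) => i j.
by rewrite !dvecSS IH powRM // dvec_ge0.
Qed.

(** [A] may have off-diagonal entries: this gives the distribution of a product state measured in a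
    product basis. *)
Lemma tpow_diag (A : 'M[C]_D) (r : 'I_D -> R) k x :
  (forall j, A j j = (r j)%:C%C) -> tpow A k x x = (dvec r k x)%:C%C.
Proof.
move=> h; case: k x => [|k] x; first by rewrite mxE eqxx.
elim: k x => [|k IH] x; first exact: h.
case: (mxtens_indexP x) => i j.
by rewrite dvecSS tpowSS tensmxE h IH rmorphM.
Qed.

Lemma tpow_dmx (f : 'I_D -> R) k : tpow (dmx f) k = dmx (dvec f k).
Proof.
case: k => [|k]; first by apply/matrixP => i j; rewrite dmxE !mxE.
elim: k => [|k IH]; first by [].
apply/matrixP => x y; case: (mxtens_indexP x) => i j; case: (mxtens_indexP y) => i' j'.
rewrite tpowSS tensmxE IH !dmxE dvecSS.
rewrite (inj_eq (can_inj (@mxtens_indexK _ _))) xpair_eqE rmorphM.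
by case: eqP => _; case: eqP => _; rewrite ?mulr1n ?mulr0n ?mulr0 ?mul0r.
Qed.

Lemma tpow_spec (U : 'M[C]_D) p k : tpow (spec U p) k = spec (tpow U k) (dvec p k).
Proof. by rewrite /spec !tpow_mul adj_tpow tpow_dmx. Qed.

End Product.

(** * Regrouping tensor factors into blocks *)

Section Packing.

(* Square matrices of unspecified size, on which the tensor product is strictly
   associative. *)
Definition mxpack n (A : 'M[C]_n) : {n & 'M[C]_n} := existT _ n A.

Lemma mxpack_cast m n (e : m = n) (A : 'M[C]_m) (B : 'M[C]_n) :
  castmx (e, e) A = B -> mxpack A = mxpack B.
Proof. by case: n / e B => B; rewrite castmx_id => ->. Qed.

Lemma cast_mxpack m n (A : 'M[C]_m) (B : 'M[C]_n) :
  mxpack A = mxpack B -> exists e : m = n, castmx (e, e) A = B.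
Proof.
(* Stated for arbitrary packed matrices, the equality can be rewritten and the equation of sizes
   becomes [erefl]. *)
suff h (x y : {n & 'M[C]_n}) : x = y ->
    exists e : projT1 x = projT1 y, castmx (e, e) (projT2 x) = projT2 y.
  by move=> /h.
by move=> ->; exists erefl; rewrite castmx_id.
Qed.

Definition tensP (x y : {n & 'M[C]_n}) := mxpack (projT2 x *t projT2 y).

Lemma tensPA : associative tensP.
Proof.
move=> [m A] [n B] [p E]; rewrite /tensP /=.
apply: (@mxpack_cast _ _ (mulnA m n p)); apply/matrixP => x y.
case: (mxtens_indexP x) => x' x2; case: (mxtens_indexP y) => y' y2.
case: (mxtens_indexP x') => x0 x1; case: (mxtens_indexP y') => y0 y1.
rewrite castmxE !tensmxE.
have h (z0 : 'I_m) (z1 : 'I_n) (z2 : 'I_p) :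
    cast_ord (esym (mulnA m n p)) (mxtens_index (mxtens_index (z0, z1), z2)) =
    mxtens_index (z0, mxtens_index (z1, z2)).
  by apply: val_inj; rewrite /= mulnDl mulnA addnA.
by rewrite !h !tensmxE mulrA.
Qed.

Lemma tens1P x : tensP (mxpack (1%:M : 'M[C]_1)) x = x.
Proof.
case: x => n A; rewrite /tensP /= tens_scalar1mx; symmetry.
by apply: (mxpack_cast (e := esym (mul1n n))).
Qed.

Lemma tensP1 x : tensP x (mxpack (1%:M : 'M[C]_1)) = x.
Proof.
case: x => n A; rewrite /tensP /= tens_mx_scalar scale1r; symmetry.
by apply: (mxpack_cast (e := esym (muln1 n))).
Qed.

Lemma tpowSP d (A : 'M[C]_d) k : mxpack (tpow A k.+1) = tensP (mxpack A) (mxpack (tpow A k)).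
Proof. by case: k => //; rewrite tensP1. Qed.

Lemma tpowDP d (A : 'M[C]_d) m k :
  mxpack (tpow A (m + k)) = tensP (mxpack (tpow A m)) (mxpack (tpow A k)).
Proof. by elim: m => [|m IH]; rewrite ?tens1P // addSn !tpowSP IH tensPA. Qed.

Lemma tpowMP d (A : 'M[C]_d) m k :
  mxpack (tpow (tpow A m) k) = mxpack (tpow A (m * k)).
Proof. by elim: k => [|k IH]; rewrite ?muln0 // tpowSP IH mulnS tpowDP. Qed.

(** The cast must be the same for all [A], since one test is compared with several states. It is
    read off at [A = 0] and transferred by uniqueness of equality proofs on [nat]. *)
Lemma tpow_blocks d m k r : exists e : ((d ^ m) ^ k * d ^ r = d ^ (m * k + r))%N,
  forall A : 'M[C]_d, castmx (e, e) (tpow (tpow A m) k *t tpow A r) = tpow A (m * k + r).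
Proof.
have h (A : 'M[C]_d) :
    mxpack (tpow (tpow A m) k *t tpow A r) = mxpack (tpow A (m * k + r)).
  by rewrite tpowDP -tpowMP.
have [e _] := cast_mxpack (h 0); exists e => A.
by have [e' <-] := cast_mxpack (h A); congr (castmx (_, _)); apply: eq_irrelevance.
Qed.

Lemma adj_cast m n (e : m = n) (A : 'M[C]_m) : adj (castmx (e, e) A) = castmx (e, e) (adj A).
Proof. by case: n / e; rewrite !castmx_id. Qed.

Lemma mul_cast m n (e : m = n) (A B : 'M[C]_m) :
  castmx (e, e) A *m castmx (e, e) B = castmx (e, e) (A *m B).
Proof. by case: n / e; rewrite !castmx_id. Qed.

Lemma trace_cast m n (e : m = n) (A : 'M[C]_m) : \tr (castmx (e, e) A) = \tr A.
Proof. by case: n / e; rewrite castmx_id. Qed.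

(** The test ignores the last [r] factors, which covers lengths that are not multiples of [m]. *)
Lemma extend_test d m k r (T : 'M[C]_((d ^ m) ^ k)) : adj T = T -> T *m T = T ->
  exists T' : 'M[C]_(d ^ (m * k + r)), [/\ adj T' = T', T' *m T' = T',
    forall A, T *m tpow (tpow A m) k = tpow (tpow A m) k *m T ->
      T' *m tpow A (m * k + r) = tpow A (m * k + r) *m T' &
    forall A, \tr (tpow A (m * k + r) *m T') =
      \tr (tpow (tpow A m) k *m T) * \tr (tpow A r)].
Proof.
move=> aT TT; have [e he] := tpow_blocks d m k r.
exists (castmx (e, e) (T *t 1%:M)); split.
- by rewrite adj_cast adj_tens aT adj_mx1.
- by rewrite mul_cast tensmx_mul TT mulmx1.
- by move=> A cA; rewrite -he !mul_cast !tensmx_mul cA mul1mx mulmx1.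
- by move=> A; rewrite -he mul_cast trace_cast tensmx_mul trace_tens mulmx1.
Qed.

End Packing.

End Tensor.
Arguments dvec {R D} f k x.

(** * Chernoff bounds and the direct part for a pair of states *)

Section Stein.
Variable R : realType.
Local Notation C := R[i].

(** [expR z <= (1 - z)^-1], and [(1 + z + 2 z^2) (1 - z) = 1 + z^2 (1 - 2 z) >= 1]. *)
Lemma expR_le_quad (z : R) : `|z| <= 2^-1 -> expR z <= 1 + z + 2 * z ^+ 2.
Proof.
rewrite ler_norml => /andP[h1 h2].
have hz : 0 < 1 - z by lra.
have h3 : expR z <= (1 - z)^-1.
  by rewrite -[z in expR z]opprK expRN lef_pV2 ?posrE ?expR_gt0 // expR_ge1Dx.
apply: (le_trans h3); rewrite -[X in X <= _]mul1r ler_pdivrMr //.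
have := sqr_ge0 z; nra.
Qed.

(** The moment generating function is 1 at 0 with negative slope there, so it is below 1 at some
    small positive [s]. *)
Lemma chernoff_lt1 n (w x : 'I_n -> R) : (forall i, 0 <= w i) -> \sum_i w i = 1 ->
  \sum_i w i * x i < 0 -> exists2 s, 0 < s & \sum_i w i * expR (s * x i) < 1.
Proof.
move=> hw w1; set mu := \sum_i _ => hmu.
pose M := \sum_i `|x i|; pose V := \sum_i w i * x i ^+ 2.
have hM : 0 <= M by rewrite sumr_ge0.
have hV : 0 <= V by rewrite sumr_ge0 // => i _; rewrite mulr_ge0 ?sqr_ge0.
(* The first bound keeps every [s * x i] in the range of [expR_le_quad]; the second makes the
   quadratic term smaller than the linear gain. *)
pose s := Num.min (2 * (M + 1))^-1 (- mu / (4 * (V + 1))).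
have hs : 0 < s.
  rewrite lt_min invr_gt0 divr_gt0 ?andbT; lra.
have hs1 : s * (2 * (M + 1)) <= 1.
  rewrite -ler_pdivlMr ?div1r ?ge_min ?lexx //; lra.
have hs2 : s * (4 * (V + 1)) <= - mu.
  rewrite -ler_pdivlMr ?ge_min ?lexx ?orbT //; lra.
exists s => //.
have h i : w i * expR (s * x i) <= w i * (1 + s * x i + 2 * (s * x i) ^+ 2).
  rewrite ler_wpM2l // expR_le_quad // normrM (gtr0_norm hs).
  have : `|x i| <= M by rewrite /M (bigD1 i) //= lerDl sumr_ge0.
  have := normr_ge0 (x i); nra.
apply: (le_lt_trans (ler_sum _ (fun i _ => h i))).
have -> : \sum_i w i * (1 + s * x i + 2 * (s * x i) ^+ 2) = 1 + s * mu + 2 * s ^+ 2 * V.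
  rewrite -[X in _ = X + _ + _]w1 /mu /V !mulr_sumr -!big_split /=; apply: eq_bigr => i _; ring.
have : 2 * s * V < - mu by nra.
nra.
Qed.

Lemma expR_powR_exprn (b s : R) k : (expR b `^ s) ^+ k = (expR b ^+ k) `^ s.
Proof.
rewrite -[expR b ^+ k]expRM_natl /powR !gt_eqF ?expR_gt0 // !expRK -expRM_natl.
by congr expR; ring.
Qed.

(** Markov's inequality: the product weight [phi] dominates the indicator of [B], and the full sum
    factorises. *)
Lemma dvec_tail D (w phi : 'I_D -> R) k (B : pred 'I_(D ^ k)) :
  (forall i, 0 <= w i) -> (forall i, 0 <= phi i) ->
  (forall x, B x -> dvec w k x <= dvec w k x * dvec phi k x) ->
  \sum_(x | B x) dvec w k x <= (\sum_i w i * phi i) ^+ k.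
Proof.
move=> hw hphi hB; rewrite -sum_dvec big_mkcond /=; apply: ler_sum => x _.
rewrite dvecM; case: ifP => [/hB //|_]; by rewrite mulr_ge0 ?dvec_ge0.
Qed.

(** Under [p] the mean of [lnz (p i)] exceeds [a], so the exponential tilt by [(expR a / p i) ^ s]
    gives a rate [th] independent of [k]. *)
Lemma lower_tail D (p : 'I_D -> R) (a : R) : (forall i, 0 <= p i) -> \sum_i p i = 1 ->
  a < \sum_i p i * lnz (p i) -> exists2 th, 0 <= th < 1 &
  forall k, \sum_(x | dvec p k x < expR a ^+ k) dvec p k x <= th ^+ k.
Proof.
move=> hp p1 ha.
have [|s hs hlt] := @chernoff_lt1 D p (fun i => a - lnz (p i)) hp p1.
  under eq_bigr do rewrite mulrBr.
  by rewrite sumrB -mulr_suml p1 mul1r subr_lt0.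
pose phi i := expR a `^ s * p i `^ (- s).
have e : \sum_i p i * phi i = \sum_i p i * expR (s * (a - lnz (p i))).
  apply: eq_bigr => i _; have [->|hi] := eqVneq (p i) 0; first by rewrite !mul0r.
  have hi0 : 0 < p i by rewrite lt_neqAle eq_sym hi hp.
  rewrite /phi lnz_gt0 // /powR (gt_eqF hi0) (gt_eqF (expR_gt0 a)) -expRD expRK.
  by congr (_ * expR _); ring.
exists (\sum_i p i * phi i).
  rewrite e hlt andbT sumr_ge0 // => i _; by rewrite mulr_ge0 ?expR_ge0.
move=> k; apply: dvec_tail => // [i|x hx]; first by rewrite mulr_ge0 ?powR_ge0.
have := dvec_ge0 x hp; rewrite le_eqVlt => /orP[/eqP<-|h0]; first by rewrite mul0r.
rewrite ler_peMr ?(ltW h0) // dvecM dvec_cst dvec_powR // powRN.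
rewrite -[X in X <= _](@divff _ (dvec p k x `^ s)) ?gt_eqF ?powR_gt0 //.
rewrite ler_pM2r ?invr_gt0 ?powR_gt0 //.
rewrite expR_powR_exprn.
by apply: ge0_ler_powR; rewrite ?nnegrE ?(ltW hs) ?(ltW h0) ?exprn_ge0 ?expR_ge0 // ltW.
Qed.

(** The tilt is now by [(q i / expR b) ^ s]. Where [q i = 0] the default value of [lnz] does no
    harm, as [r i] vanishes there. *)
Lemma upper_tail D (r q : 'I_D -> R) (b : R) : (forall i, 0 <= r i) -> \sum_i r i = 1 ->
  (forall i, 0 <= q i) -> (forall i, q i = 0 -> r i = 0) ->
  \sum_i r i * lnz (q i) < b -> exists2 th, 0 <= th < 1 &
  forall k, \sum_(x | expR b ^+ k < dvec q k x) dvec r k x <= th ^+ k.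
Proof.
move=> hr r1 hq hqr hb.
have [|s hs hlt] := @chernoff_lt1 D r (fun i => lnz (q i) - b) hr r1.
  under eq_bigr do rewrite mulrBr.
  by rewrite sumrB -mulr_suml r1 mul1r subr_lt0.
pose phi i := expR b `^ (- s) * q i `^ s.
have e : \sum_i r i * phi i = \sum_i r i * expR (s * (lnz (q i) - b)).
  apply: eq_bigr => i _; have [hi|hi] := eqVneq (q i) 0; first by rewrite hqr // !mul0r.
  have hi0 : 0 < q i by rewrite lt_neqAle eq_sym hi hq.
  rewrite /phi lnz_gt0 // /powR (gt_eqF hi0) (gt_eqF (expR_gt0 b)) -expRD expRK.
  by congr (_ * expR _); ring.
exists (\sum_i r i * phi i).
  rewrite e hlt andbT sumr_ge0 // => i _; by rewrite mulr_ge0 ?expR_ge0.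
move=> k; apply: dvec_tail => // [i|x hx]; first by rewrite mulr_ge0 ?powR_ge0.
rewrite ler_peMr ?dvec_ge0 // dvecM dvec_cst dvec_powR //.
have -> : (expR b `^ (- s)) ^+ k = ((expR b ^+ k) `^ s)^-1.
  by rewrite powRN exprVn expR_powR_exprn.
have hb0 : 0 < expR b ^+ k by rewrite exprn_gt0 ?expR_gt0.
rewrite mulrC ler_pdivlMr ?powR_gt0 // mul1r.
by apply: ge0_ler_powR; rewrite ?nnegrE ?(ltW hs) ?(ltW hb0) ?dvec_ge0 // ltW.
Qed.

Lemma stein_direct D (rho sigma : 'M[C]_D) (b : R) : density rho -> density sigma ->
  loewner_le (supp rho) (supp sigma) -> b < fine (relent rho sigma) ->
  exists2 th : R, 0 <= th < 1 & forall k, exists T : 'M[C]_(D ^ k),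
  [/\ adj T = T, T *m T = T,
    forall X, X *m tpow rho k = tpow rho k *m X -> X *m tpow sigma k = tpow sigma k *m X ->
      X *m T = T *m X,
    complex.Re (\tr (tpow rho k *m (1%:M - T))) <= 2 * th ^+ k &
    complex.Re (\tr (tpow sigma k *m T)) <= expR (- (k%:R * b))].
Proof.
move=> [hr tr1] [hs ts1] hle.
have [U [p [V [q [hU hV er es [hp hq hW -> /=]]]]]] := relentP hr hs hle.
have hUV := unitary_mul hU (unitary_adj hV).
have p1 : \sum_i p i = 1 by rewrite er in tr1; exact: trace_density_spec tr1.
(* The outcome distribution of [rho] measured in the eigenbasis of [sigma]. The relative entropy
   splits as [H - K], the means of [lnz p] under [p] and of [lnz q] under [r]. *)
pose r j := \sum_i p i * sqnorm ((U *m adj V) i j).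
have hr0 j : 0 <= r j by rewrite sumr_ge0 // => i _; rewrite mulr_ge0 ?sqnorm_ge0.
have r1 : \sum_j r j = 1.
  rewrite /r exchange_big -p1; apply: eq_bigr => i _.
  by rewrite -mulr_sumr unitary_sqnorm_row // mulr1.
have hqr j : q j = 0 -> r j = 0.
  move=> qj; rewrite /r big1 // => i _; have [->|hi] := eqVneq (p i) 0; first by rewrite mul0r.
  by rewrite hW // mulr0.
have -> : \sum_i \sum_j sqnorm ((U *m adj V) i j) * (p i * (lnz (p i) - lnz (q j))) =
    \sum_i p i * lnz (p i) - \sum_j r j * lnz (q j).
  transitivity (\sum_i \sum_j (p i * lnz (p i) * sqnorm ((U *m adj V) i j) -
      p i * sqnorm ((U *m adj V) i j) * lnz (q j))).
    by apply: eq_bigr => i _; apply: eq_bigr => j _; ring.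
  under eq_bigr do rewrite sumrB; rewrite sumrB; congr (_ - _).
    by apply: eq_bigr => i _; rewrite -mulr_sumr unitary_sqnorm_row // mulr1.
  by rewrite exchange_big; apply: eq_bigr => j _; rewrite /r mulr_suml.
set H := \sum_i p i * _; set K := \sum_j r j * _ => hb.
(* Each threshold moves by [e] away from its mean; the ratio of the thresholds is then exactly
   [expR (- (k b))], since [H - K - 2 e = b]. *)
pose e := (H - K - b) / 2; have he : 0 < e by rewrite /e; lra.
have [|th1 /andP[th1a th1b] ht1] := @lower_tail D p (H - e) hp p1; first by rewrite -/H; lra.
have [|th2 /andP[th2a th2b] ht2] := @upper_tail D r q (K + e) hr0 r1 hq hqr.
  by rewrite -/K; lra.
exists (Num.max th1 th2); first by rewrite le_max th1a /= gt_max th1b th2b.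
move=> k.
have hUk := unitary_tpow k hU; have hVk := unitary_tpow k hV.
have [T [aT TT cT h0 h1]] := @range_test R (D ^ k) (tpow U k) (dvec p k) (tpow V k) (dvec q k)
  (expR (H - e) ^+ k) (expR (K + e) ^+ k) hUk hVk
  (fun x => dvec_ge0 x hp) (fun x => dvec_ge0 x hq)
  (exprn_gt0 _ (expR_gt0 _)) (exprn_ge0 _ (expR_ge0 _)).
rewrite -!tpow_spec -er -es in cT h0 h1.
exists T; split=> //.
  apply: (le_trans h0).
  have -> : 2 * Num.max th1 th2 ^+ k = Num.max th1 th2 ^+ k + Num.max th1 th2 ^+ k.
    by ring.
  apply: lerD.
    by apply: (le_trans (ht1 k)); rewrite lerXn2r ?nnegrE ?le_max ?th1a ?lexx.
  (* The inner sums are the diagonal entries of the [k]-th tensor power of [V rho adj V], hence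
     product weights of [r]. *)
  have -> : \sum_(j | expR (K + e) ^+ k < dvec q k j)
      \sum_i dvec p k i * sqnorm ((tpow U k *m adj (tpow V k)) i j) =
      \sum_(j | expR (K + e) ^+ k < dvec q k j) dvec r k j.
    apply: eq_bigr => j _; apply: (@complexI R); rewrite -spec_conj -tpow_spec adj_tpow.
    by rewrite -!tpow_mul; apply: tpow_diag => i; rewrite spec_conj.
  apply: (le_trans (ht2 k)); rewrite lerXn2r ?nnegrE ?le_max ?th2a ?lexx ?orbT //.
apply: (le_trans h1); rewrite sum_dvec p1 expr1n mulr1 -expr_div_n -expRB.
by rewrite -expRM_natl ler_expR -mulrN /e; lra.
Qed.

End Stein.


(** * Continuity of matrix-valued functions on the group *)

Section Continuity.
Variables (R : realType) (G : ptopologicalType).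
Local Notation C := R[i].

Definition ccont (f : G -> C) : Prop :=
  continuous ((fun g => complex.Re (f g)) : G -> R) /\
  continuous ((fun g => complex.Im (f g)) : G -> R).

Lemma eq_cont (f h : G -> R) : f =1 h -> continuous f -> continuous h.
Proof. by move=> /funext ->. Qed.

Lemma eq_ccont f h : f =1 h -> ccont f -> ccont h.
Proof. by move=> /funext ->. Qed.

Lemma ccont_cst c : ccont (fun=> c).
Proof. by split=> g; exact: cvg_cst. Qed.

Lemma ccontD f h : ccont f -> ccont h -> ccont (fun g => f g + h g).
Proof.
move=> [f1 f2] [h1 h2]; split.
  apply: (@eq_cont (fun g => complex.Re (f g) + complex.Re (h g))) => [g|g].
    by rewrite ReD.
  by apply: cvgD; [exact: f1|exact: h1].
apply: (@eq_cont (fun g => complex.Im (f g) + complex.Im (h g))) => [g|g].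
  by rewrite ImD.
by apply: cvgD; [exact: f2|exact: h2].
Qed.

Lemma ReM (z w : C) :
  complex.Re (z * w) = complex.Re z * complex.Re w - complex.Im z * complex.Im w.
Proof. by case: z w => [a b] []. Qed.

Lemma ImM (z w : C) :
  complex.Im (z * w) = complex.Re z * complex.Im w + complex.Im z * complex.Re w.
Proof. by case: z w => [a b] []. Qed.

Lemma ccontM f h : ccont f -> ccont h -> ccont (fun g => f g * h g).
Proof.
move=> [f1 f2] [h1 h2]; split.
  apply: (@eq_cont (fun g => complex.Re (f g) * complex.Re (h g) -
                             complex.Im (f g) * complex.Im (h g))) => [g|g].
    by rewrite ReM.
  apply: cvgB.
    by apply: cvgM; [exact: f1|exact: h1].
  by apply: cvgM; [exact: f2|exact: h2].
apply: (@eq_cont (fun g => complex.Re (f g) * complex.Im (h g) +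
                           complex.Im (f g) * complex.Re (h g))) => [g|g].
  by rewrite ImM.
apply: cvgD.
  by apply: cvgM; [exact: f1|exact: h2].
by apply: cvgM; [exact: f2|exact: h1].
Qed.

Lemma ccont_conj f : ccont f -> ccont (fun g => Num.conj (f g)).
Proof.
have hr (z : C) : complex.Re (Num.conj z) = complex.Re z by case: z.
have hi (z : C) : complex.Im (Num.conj z) = - complex.Im z by case: z.
move=> [f1 f2]; split; first by apply: eq_cont f1 => g; rewrite hr.
apply: (@eq_cont (fun g => - complex.Im (f g))) => [g|g]; first by rewrite hi.
by apply: cvgN; exact: f2.
Qed.

Lemma ccont_sum (I : Type) (s : seq I) (f : I -> G -> C) :
  (forall i, ccont (f i)) -> ccont (fun g => \sum_(i <- s) f i g).
Proof.
move=> hf; elim: s => [|i s IH].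
  by apply: eq_ccont (ccont_cst 0) => g; rewrite big_nil.
by apply: eq_ccont (ccontD (hf i) IH) => g; rewrite big_cons.
Qed.

Definition mcont m n (F : G -> 'M[C]_(m, n)) : Prop := forall i j, ccont (fun g => F g i j).

Lemma mcont_cst m n (A : 'M[C]_(m, n)) : mcont (fun=> A).
Proof. by move=> i j; apply: ccont_cst. Qed.

Lemma mcont_mul m n p (F : G -> 'M[C]_(m, n)) (H : G -> 'M[C]_(n, p)) :
  mcont F -> mcont H -> mcont (fun g => F g *m H g).
Proof.
move=> hF hH i j; apply: (@eq_ccont (fun g => \sum_k F g i k * H g k j)) => [g|].
  by rewrite mxE.
by apply: ccont_sum => k; apply: ccontM.
Qed.

Lemma mcont_adj m n (F : G -> 'M[C]_(m, n)) : mcont F -> mcont (fun g => adj (F g)).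
Proof.
move=> hF i j; apply: (@eq_ccont (fun g => Num.conj (F g j i))) => [g|].
  by rewrite adjE.
exact: ccont_conj.
Qed.

Lemma mcont_tens m n p q (F : G -> 'M[C]_(m, n)) (H : G -> 'M[C]_(p, q)) :
  mcont F -> mcont H -> mcont (fun g => F g *t H g).
Proof.
move=> hF hH i j; case: (mxtens_indexP i) => i0 i1; case: (mxtens_indexP j) => j0 j1.
apply: (@eq_ccont (fun g => F g i0 j0 * H g i1 j1)) => [g|]; first by rewrite tensmxE.
exact: ccontM.
Qed.

Lemma mcont_tpow d (F : G -> 'M[C]_d) k : mcont F -> mcont (fun g => tpow (F g) k).
Proof.
move=> hF; case: k => [|k]; first exact: mcont_cst.
by elim: k => // k IH; apply: (mcont_tens hF IH).
Qed.

End Continuity.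

(** * Haar integration and the averaged states *)

Section Haar.
Variables (R : realType) (G : ptopologicalType).
Variables (mul : G -> G -> G) (inv : G -> G) (one : G).
Variable mu : {measure set (borel G) -> \bar R}.
Hypothesis hG : compact_group mul inv one.
Hypothesis hmu : normalized_haar mul mu.
Local Notation C := R[i].

Lemma continuous_borel (f : G -> R) : continuous f -> measurable_fun setT (f : borel G -> R).
Proof.
move=> /continuousP cf; apply: (measurability _ (RGenOpens.measurableE R)).
move=> _ [_ [a [b ->] <-]]; rewrite setTI.
by apply: sub_sigma_algebra; apply: cf; apply: interval_open.
Qed.

(** A continuous function is bounded on the compact group, whose measure is finite. *)
Lemma continuous_integrable (f : G -> R) : continuous f ->
  mu.-integrable setT (EFin \o (f : borel G -> R)).
Proof.
move=> cf; apply: measurable_bounded_integrable => //.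
- by rewrite (hmu.1) ltry.
- exact: continuous_borel.
- have hc : compact [set: G] by case: hG.2.
  have hw : {within [set: G], continuous f} by apply: continuous_subspaceT.
  have /compact_bounded[M [_ mrt]] := continuous_compact hw hc.
  by exists M; split; rewrite ?num_real // => y hy x _; apply: mrt => //; exists x.
Qed.

Lemma mulVK (h : G) : cancel (mul h) (mul (inv h)).
Proof. by move=> g; case: hG => -[A I V] _; rewrite A V I. Qed.

Lemma mulKV (h : G) : cancel (mul (inv h)) (mul h).
Proof.
(* The axioms provide left inverses only; the other cancellation follows because [mul (inv h)] is
   injective. *)
have cancelV (g k : G) : mul (inv h) g = mul (inv h) k -> g = k.
  by move=> e; have := congr1 (mul (inv (inv h))) e; rewrite !mulVK.
by move=> g; apply: cancelV; rewrite mulVK.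
Qed.

Lemma continuous_mul (h : G) : continuous (mul h).
Proof.
move=> g; have cm : continuous (fun p : G * G => mul p.1 p.2) by case: hG.2.
apply: (@continuous_comp _ _ _ (fun g => (h, g)) (fun p : G * G => mul p.1 p.2)); last exact: cm.
by apply: cvg_pair; [exact: cvg_cst|exact: cvg_id].
Qed.

Lemma measurable_mul (h : G) : measurable_fun setT (mul h : borel G -> borel G).
Proof.
apply: (@measurability _ _ (borel G) (borel G) setT (mul h) (@open G)) => //.
move=> _ [A oA <-]; rewrite setTI; apply: sub_sigma_algebra.
by have /continuousP := @continuous_mul h; apply.
Qed.

(** The pushforward of [mu] by [mul h] is [mu]: a preimage under [mul h] is an image under
    [mul (inv h)]. *)
Lemma Rintegral_translate (h : G) (f : G -> R) : continuous f ->
  Rintegral mu setT (fun g => f (mul h g)) = Rintegral mu setT f.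
Proof.
move=> cf.
have cfh : continuous (fun g => f (mul h g)).
  by move=> g; apply: continuous_comp; [exact: continuous_mul|exact: cf].
rewrite /Rintegral; congr fine.
pose phi : {mfun borel G >-> borel G} := mfun_Sub (mem_set (measurable_mul h)).
rewrite -[LHS](@integral_pushforward _ _ _ _ _ phi _ mu setT (EFin \o f)) //; first last.
- exact: continuous_integrable.
- by apply/measurable_EFinP; exact: continuous_borel.
apply: eq_measure_integral => A mA _.
transitivity (mu (mul (inv h) @` A)); last exact: hmu.2.
rewrite -[LHS]/(mu (mul h @^-1` A)); congr (mu _).
apply/seteqP; split=> [g hg|_ [g hg <-]]; first by exists (mul h g) => //; exact: mulVK.
by rewrite /= mulKV.
Qed.

Lemma cintegral_cst (c : C) : cintegral mu (fun=> c) = c.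
Proof. by rewrite /cintegral !Rintegral_cst // hmu.1 /= !mulr1; case: c. Qed.

Lemma cintegral_ge0 (f : G -> C) : (forall g, 0 <= f g) -> 0 <= cintegral mu f.
Proof.
move=> hf; rewrite lecE /=; apply/andP; split.
  rewrite (@eq_Rintegral _ _ _ _ _ (fun=> 0)) ?Rintegral_cst ?mul0r // => g _.
  by have := hf g; rewrite lecE => /andP[/eqP->].
by apply: Rintegral_ge0 => g _; have := hf g; rewrite lecE => /andP[].
Qed.

Lemma cintegralD (f h : G -> C) : ccont f -> ccont h ->
  cintegral mu (fun g => f g + h g) = cintegral mu f + cintegral mu h.
Proof.
move=> [f1 f2] [h1 h2]; rewrite /cintegral.
under eq_Rintegral do rewrite ReD.
under [X in Complex _ X]eq_Rintegral do rewrite ImD.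
by rewrite !RintegralD //; apply: continuous_integrable.
Qed.

Lemma cintegralZ (c : C) (f : G -> C) : ccont f ->
  cintegral mu (fun g => c * f g) = c * cintegral mu f.
Proof.
move=> [f1 f2]; rewrite /cintegral.
have hi (a : R) (k : G -> R) : continuous k -> continuous (fun g => a * k g).
  by move=> ck g; apply: cvgM; [exact: cvg_cst|exact: ck].
have hI (k : G -> R) : continuous k -> mu.-integrable setT (EFin \o (k : borel G -> R)).
  exact: continuous_integrable.
under eq_Rintegral do rewrite ReM.
under [X in Complex _ X]eq_Rintegral do rewrite ImM.
rewrite RintegralB // ?RintegralD // ?RintegralZl //; try exact: hI; try (apply: hI; exact: hi).
by case: c.
Qed.

Lemma cintegral_conj (f : G -> C) : ccont f ->
  Num.conj (cintegral mu f) = cintegral mu (fun g => Num.conj (f g)).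
Proof.
move=> [_ f2]; rewrite /cintegral /=; congr Complex.
  by apply: eq_Rintegral => g _; case: (f g).
rewrite -mulN1r -RintegralZl //; last exact: continuous_integrable.
by apply: eq_Rintegral => g _; case: (f g) => a b /=; rewrite mulN1r.
Qed.

Lemma cintegral_sum (I : Type) (s : seq I) (f : I -> G -> C) : (forall i, ccont (f i)) ->
  cintegral mu (fun g => \sum_(i <- s) f i g) = \sum_(i <- s) cintegral mu (f i).
Proof.
move=> hf; elim: s => [|i s IH].
  rewrite big_nil -[RHS]cintegral_cst; congr cintegral; apply/funext => g.
  by rewrite big_nil.
rewrite big_cons -IH -cintegralD //; last exact: ccont_sum.
by congr cintegral; apply/funext => g; rewrite big_cons.
Qed.

Lemma cintegral_translate (h : G) (f : G -> C) : ccont f ->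
  cintegral mu (fun g => f (mul h g)) = cintegral mu f.
Proof.
move=> [f1 f2]; rewrite /cintegral.
by rewrite (Rintegral_translate h f1) (Rintegral_translate h f2).
Qed.

(** Explicit coefficients let a form pass through the entrywise integral by finite sums alone. *)
Definition linform m n (L : 'M[C]_(m, n) -> C) : Prop :=
  exists c : 'I_m * 'I_n -> C, forall A, L A = \sum_ab c ab * A ab.1 ab.2.

Lemma linform_entry m n p q (B : 'M[C]_(p, m)) (E : 'M[C]_(n, q)) i j :
  linform (fun A => (B *m A *m E) i j).
Proof.
exists (fun ab => B i ab.1 * E ab.2 j) => A; rewrite mxE.
under eq_bigr do rewrite mxE mulr_suml.
rewrite exchange_big pair_big /=; apply: eq_bigr => -[a b] _ /=; ring.
Qed.

Lemma linform_sum m n (I : Type) (s : seq I) (L : I -> 'M[C]_(m, n) -> C) :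
  (forall i, linform (L i)) -> linform (fun A => \sum_(i <- s) L i A).
Proof.
move=> hL; elim: s => [|i s [c hc]].
  by exists (fun=> 0) => A; rewrite big_nil big1 // => ab _; rewrite mul0r.
have [e he] := hL i; exists (fun ab => e ab + c ab) => A; rewrite big_cons hc he -big_split.
by apply: eq_bigr => ab _; rewrite mulrDl.
Qed.

Lemma linform_trace m (T : 'M[C]_m) : linform (fun A => \tr (A *m T)).
Proof.
have [c hc] : linform (fun A : 'M[C]_m => \sum_i (1%:M *m A *m T) i i).
  by apply: linform_sum => i; apply: linform_entry.
by exists c => A; rewrite -hc mul1mx.
Qed.

Section Average.
Variables (d : nat) (u : G -> 'M[C]_d).
Hypothesis hu : unitary_rep mul one u.

Lemma mcont_rep n (X : 'M[C]_(d ^ n)) :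
  mcont (fun g => tpow (u g) n *m X *m adj (tpow (u g) n)).
Proof.
have hc : mcont (fun g => tpow (u g) n).
  by apply: mcont_tpow => i j; case: hu => _ _ _ h1 h2; split.
apply: mcont_mul; last exact: mcont_adj.
by apply: mcont_mul => //; apply: mcont_cst.
Qed.

Lemma unitary_rep_tpow n g : unitary (tpow (u g) n).
Proof. by apply: unitary_tpow; case: hu. Qed.

Lemma EA_linform n X (L : 'M[C]_(d ^ n) -> C) : linform L ->
  L (EA mu u X) = cintegral mu (fun g => L (tpow (u g) n *m X *m adj (tpow (u g) n))).
Proof.
move=> [c hc]; rewrite hc.
transitivity (\sum_ab cintegral mu (fun g =>
    c ab * (tpow (u g) n *m X *m adj (tpow (u g) n)) ab.1 ab.2)).
  apply: eq_bigr => ab _; rewrite cintegralZ; last exact: mcont_rep.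
  by rewrite mxE.
rewrite -cintegral_sum; last first.
  by move=> ab; apply: ccontM; [exact: ccont_cst|exact: mcont_rep].
by congr cintegral; apply/funext => g; rewrite hc.
Qed.

Lemma EA_invariant n X (L : 'M[C]_(d ^ n) -> C) : linform L ->
  (forall g, L (tpow (u g) n *m X *m adj (tpow (u g) n)) = L X) ->
  L (EA mu u X) = L X.
Proof.
move=> hL hi; rewrite EA_linform // -[RHS]cintegral_cst.
by congr cintegral; apply/funext.
Qed.

(** Cyclicity of the trace moves the unitary across [T], where it cancels: invariant tests cannot
    distinguish a state from its average. *)
Lemma EA_trace_test n (X T : 'M[C]_(d ^ n)) : in_An u T ->
  \tr (EA mu u X *m T) = \tr (X *m T).
Proof.
move=> hT; apply: (EA_invariant (linform_trace T)) => g.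
rewrite -!mulmxA mxtrace_mulC -!mulmxA hT (mulmxA (adj _)).
by rewrite (unitaryV (unitary_rep_tpow n g)) mul1mx.
Qed.

Lemma psd_EA n (X : 'M[C]_(d ^ n)) : psd X -> psd (EA mu u X).
Proof.
move=> [aX hX]; split=> [|v].
  apply/matrixP => i j; rewrite adjE.
  rewrite !mxE cintegral_conj; last exact: mcont_rep.
  congr cintegral; apply/funext => g.
  by rewrite -adjE !adjM adjK aX mulmxA.
rewrite (EA_linform X (linform_entry v (adj v) 0 0)); apply: cintegral_ge0 => g.
rewrite !mulmxA; have := hX (v *m tpow (u g) n).
by rewrite adjM !mulmxA.
Qed.

Lemma density_EA n (X : 'M[C]_(d ^ n)) : density X -> density (EA mu u X).
Proof.
move=> [hX tX]; split; first exact: psd_EA.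
rewrite -[EA _ _ _]mulmx1 EA_trace_test ?mulmx1 //.
by move=> g; rewrite mul1mx mulmx1.
Qed.

(** Conjugation by the unitary of [h] translates the integrand by [h], which leaves the integral
    unchanged. *)
Lemma EA_in_An n (X : 'M[C]_(d ^ n)) : in_An u (EA mu u X).
Proof.
move=> h; set U := tpow (u h) n.
have hU : unitary U by exact: unitary_rep_tpow.
suff e : U *m EA mu u X *m adj U = EA mu u X.
  by rewrite -{1}e -!mulmxA (unitaryV hU) mulmx1.
apply/matrixP => i j; rewrite (EA_linform X (linform_entry U (adj U) i j)) [RHS]mxE.
rewrite -(@cintegral_translate h _ (mcont_rep X i j)); congr cintegral; apply/funext => g.
by case: hu => hm _ _ _ _; rewrite hm tpow_mul adjM !mulmxA.
Qed.

(** [T] commutes with the group acting on any single block, so the averages can be removed one block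
    at a time; [Z l] has its first [l] blocks averaged. *)
Lemma trace_tpow_EA n k (X : 'M[C]_(d ^ n)) (T : 'M[C]_((d ^ n) ^ k)) :
  (forall j g, T *m ptens (upd (fun=> 1%:M) j (tpow (u g) n)) k =
               ptens (upd (fun=> 1%:M) j (tpow (u g) n)) k *m T) ->
  \tr (tpow (EA mu u X) k *m T) = \tr (tpow X k *m T).
Proof.
move=> hT; pose Z l := fun i => if (i < l)%N then EA mu u X else X.
suff h l : (l <= k)%N -> \tr (ptens (Z l) k *m T) = \tr (tpow X k *m T).
  rewrite -(h k) // tpowE; congr (\tr (_ *m _)).
  by apply: eq_ptens => i hi; rewrite /Z hi.
elim: l => [_|l IH hl]; first by rewrite tpowE.
rewrite -IH ?(ltnW hl) //; pose L A := \tr (ptens (upd (Z l) l A) k *m T).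
have -> : ptens (Z l.+1) k = ptens (upd (Z l) l (EA mu u X)) k.
  by apply: eq_ptens => i _; rewrite /Z /upd ltnS leq_eqVlt; case: eqP.
have -> : ptens (Z l) k = ptens (upd (Z l) l X) k.
  by apply: eq_ptens => i _; rewrite /Z /upd; case: eqP => [->|//]; rewrite ltnn.
apply: (@EA_invariant n X L).
  exists (fun ab => L (delta_mx ab.1 ab.2)) => A; rewrite /L ptens_upd_delta //.
  rewrite mulmx_suml raddf_sum; apply: eq_bigr => ab _ /=.
  by rewrite -scalemxAl mxtraceZ mulrC.
move=> g; set U := tpow (u g) n; rewrite /L.
have hU : unitary U by exact: unitary_rep_tpow.
pose V := ptens (upd (fun=> 1%:M) l U) k; pose V' := ptens (upd (fun=> 1%:M) l (adj U)) k.
have -> : ptens (upd (Z l) l (U *m X *m adj U)) k = V *m ptens (upd (Z l) l X) k *m V'.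
  rewrite !ptens_mul; apply: eq_ptens => i _; rewrite /upd.
  by case: eqP => // _; rewrite mul1mx mulmx1.
have hV : V' *m V = 1%:M.
  rewrite ptens_mul -[RHS](@ptens1 R (d ^ n) k); apply: eq_ptens => i _; rewrite /upd.
  by case: eqP => _; rewrite ?mulmx1 // unitaryV.
by rewrite -!mulmxA mxtrace_mulC -!mulmxA hT (mulmxA V') hV mul1mx.
Qed.

End Average.

End Haar.


(** * Limits in the extended reals *)

Section ExtendedLimits.
Variable R : realType.
Implicit Types (u : (\bar R)^nat) (x y l : \bar R).

(** Reduces inequalities to real bounds, so that a supremum equal to [+oo] needs no separate
    treatment. *)
Lemma lee_real_below x y : (forall t : R, (t%:E < x)%E -> (t%:E <= y)%E) -> (x <= y)%E.
Proof.
move=> h; rewrite leNgt; apply/negP; case: x y h => [x| |] [y| |] h //=.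
- rewrite lte_fin => hxy; have := h ((x + y) / 2); rewrite lte_fin lee_fin => /(_ ltac:(lra)); lra.
- by move=> _; have := h (x - 1); rewrite lte_fin => /(_ ltac:(lra)).
- by move=> _; have := h (y + 1); rewrite ltry lee_fin => /(_ isT); lra.
- by move=> _; have := h 0; rewrite ltry => /(_ isT).
Qed.

Lemma limn_esup_le u l : (\forall n \near \oo, (u n <= l)%E) -> (limn_esup u <= l)%E.
Proof.
move=> h; apply: (@le_trans _ _ (ereal_sup (u @` [set n | (u n <= l)%E]))).
  by apply: ereal_inf_lbound; exists [set n | (u n <= l)%E].
by apply: ge_ereal_sup => _ [n hn <-].
Qed.

Lemma limn_einf_ge u l : (\forall n \near \oo, (l <= u n)%E) -> (l <= limn_einf u)%E.
Proof.
move=> h; rewrite /limn_einf leeNr; apply: limn_esup_le.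
by apply: filterS h => n; rewrite leeN2.
Qed.

Lemma cvg_einf_esup u l : (l <= limn_einf u)%E -> (limn_esup u <= l)%E -> u @ \oo --> l.
Proof.
move=> h1 h2.
have e1 : limn_einf u = l.
  by apply/eqP; rewrite eq_le h1 andbT (le_trans (limn_einf_sup u)).
have e2 : limn_esup u = l.
  by apply/eqP; rewrite eq_le h2 /= -{1}e1 limn_einf_sup.
apply: (@squeeze_cvge _ _ _ _ (einfs u) _ (esups u)).
- apply: nearW => n; apply/andP; split.
    by apply: ereal_inf_lbound; exists n => /=.
  by apply: ereal_sup_ubound; exists n => /=.
- by rewrite -e1 limn_einf_lim; apply: is_cvg_einfs.
- by rewrite -e2 limn_esup_lim; apply: is_cvg_esups.
Qed.

End ExtendedLimits.

(** * Operations on effects *)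

Section Effects.
Variable R : realType.
Local Notation C := R[i].

Lemma psd_scale m (A : 'M[C]_m) (c : R) : 0 <= c -> psd A -> psd (c%:C%C *: A).
Proof.
move=> hc [aA hA]; split=> [|v].
  apply/matrixP => i j; rewrite adjE !mxE rmorphM -[in RHS]aA adjE; congr (_ * _).
  exact: conjc_real.
by rewrite -scalemxAr -scalemxAl mxE mulr_ge0 // ler0c.
Qed.

Lemma psdD m (A B : 'M[C]_m) : psd A -> psd B -> psd (A + B).
Proof.
move=> [aA hA] [aB hB]; split=> [|v]; first by rewrite adjD aA aB.
by rewrite mulmxDr mulmxDl mxE addr_ge0.
Qed.

Lemma psd1 m : psd (1%:M : 'M[C]_m).
Proof. by apply: psd_proj; rewrite ?adj_mx1 ?mulmx1. Qed.

Lemma retrZ m (A : 'M[C]_m) (c : R) :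
  complex.Re (\tr (c%:C%C *: A)) = c * complex.Re (\tr A).
Proof. by rewrite mxtraceZ Re_realM. Qed.

Lemma ptens_upd_comm D (A B : 'M[C]_D) j k : B *m A = A *m B ->
  ptens (upd (fun=> 1%:M) j B) k *m tpow A k = tpow A k *m ptens (upd (fun=> 1%:M) j B) k.
Proof.
move=> h; rewrite tpowE !ptens_mul; apply: eq_ptens => i _; rewrite /upd.
by case: eqP; rewrite ?mul1mx ?mulmx1.
Qed.

End Effects.

(** * Invariant tests, the converse bound and the limit of the rates *)

Section Main.
Variables (R : realType) (G : ptopologicalType).
Variables (mul : G -> G -> G) (inv : G -> G) (one : G).
Variable mu : {measure set (borel G) -> \bar R}.
Local Notation C := R[i].
Variables (d : nat) (u : G -> 'M[C]_d) (rho0 rho1 : 'M[C]_d).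
Hypothesis hG : compact_group mul inv one.
Hypothesis hmu : normalized_haar mul mu.
Hypothesis hu : unitary_rep mul one u.
Hypotheses (hr0 : density rho0) (hr1 : density rho1).
Hypothesis hsupp : forall n : nat,
  loewner_le (supp (rho_n mu u rho0 n)) (supp (rho_n mu u rho1 n)).

Let x n : R := fine (relent (rho_n mu u rho0 n) (rho_n mu u rho1 n)).

Lemma in_An1 n : in_An u (1%:M : 'M[C]_(d ^ n)).
Proof. by move=> g; rewrite mul1mx mulmx1. Qed.

Lemma in_AnB n (A B : 'M[C]_(d ^ n)) : in_An u A -> in_An u B -> in_An u (A - B).
Proof. by move=> hA hB g; rewrite mulmxBl mulmxBr hA hB. Qed.

Lemma density_rho_n rho n : density rho -> density (rho_n mu u rho n).
Proof. by move=> h; apply: (density_EA hG hmu hu); apply: density_tpow. Qed.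

Lemma beta0E n (T : 'M[C]_(d ^ n)) :
  beta0 rho0 T = 1 - complex.Re (\tr (tpow rho0 n *m T)).
Proof. by rewrite /beta0 mulmxBr mulmx1 retrB trace_tpow hr0.2 expr1n. Qed.

Lemma beta0_ge0 n (T : 'M[C]_(d ^ n)) : loewner_le T 1%:M -> 0 <= beta0 rho0 T.
Proof. by move=> hT; apply: trace_psd_ge0 => //; apply: psd_tpow; case: hr0. Qed.

(** [stein_direct] for the averaged states gives [T], which commutes with the group on each block
    since the averaged states do. So its errors on the original product states are the same. *)
Lemma block_test m (b : R) : b < x m -> exists2 th : R, 0 <= th < 1 &
  forall k r, exists T : 'M[C]_(d ^ (m * k + r)),
  [/\ adj T = T, T *m T = T, in_An u T, beta0 rho0 T <= 2 * th ^+ k &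
      beta1 rho1 T <= expR (- (k%:R * b))].
Proof.
move=> hb.
have [th hth hk] := stein_direct (density_rho_n m hr0) (density_rho_n m hr1) (hsupp m) hb.
exists th => // k r; have [T [aT TT cT h0 h1]] := hk k.
have cA rho g : tpow (u g) m *m rho_n mu u rho m = rho_n mu u rho m *m tpow (u g) m.
  by symmetry; apply: (EA_in_An hG hmu hu).
have hloc j g : T *m ptens (upd (fun=> 1%:M) j (tpow (u g) m)) k =
                ptens (upd (fun=> 1%:M) j (tpow (u g) m)) k *m T.
  by symmetry; apply: cT; apply: ptens_upd_comm.
have hav rho : \tr (tpow (rho_n mu u rho m) k *m T) = \tr (tpow (tpow rho m) k *m T).
  exact: (trace_tpow_EA hG hmu hu).
have [T' [aT' TT' cT' tT']] := extend_test r aT TT.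
exists T'; split=> //.
- move=> g; apply: cT'; symmetry; apply: cT; by rewrite -!tpow_mul cA.
- rewrite beta0E tT' trace_tpow hr0.2 expr1n mulr1 -hav.
  move: h0; rewrite mulmxBr mulmx1 retrB trace_tpow.
  by rewrite (density_rho_n m hr0).2 expr1n.
- by rewrite /beta1 tT' trace_tpow hr1.2 expr1n mulr1 -hav.
Qed.

(** [T'] is the convex combination [T + lam (1 - T)], which can raise the second error to any
    prescribed value up to 1. *)
Lemma mix_test n (T : 'M[C]_(d ^ n)) (lam : R) : adj T = T -> T *m T = T -> in_An u T ->
  0 <= lam <= 1 -> exists T' : 'M[C]_(d ^ n),
  [/\ in_An u T', loewner_le 0 T' /\ loewner_le T' 1%:M,
    beta0 rho0 T' = (1 - lam) * beta0 rho0 T &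
    beta1 rho1 T' = beta1 rho1 T + lam * (1 - beta1 rho1 T)].
Proof.
move=> aT TT cT /andP[l0 l1].
have e : 1%:M - (1%:M - (1 - lam)%:C%C *: (1%:M - T)) = (1 - lam)%:C%C *: (1%:M - T).
  by rewrite opprB addrC subrK.
exists (1%:M - (1 - lam)%:C%C *: (1%:M - T)); split.
- apply: in_AnB; first exact: in_An1.
  move=> g; rewrite -scalemxAl -scalemxAr; congr (_ *: _).
  by apply: (in_AnB _ cT); exact: in_An1.
- split.
    rewrite /loewner_le subr0.
    have -> : 1%:M - (1 - lam)%:C%C *: (1%:M - T) = T + lam%:C%C *: (1%:M - T).
      by rewrite rmorphB scalerBl scale1r !opprB addrA addrC addrA subrK.
    apply: psdD; first exact: psd_proj.
    by apply: psd_scale => //; apply: psd_compl_proj.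
  rewrite /loewner_le e; apply: psd_scale; first by rewrite subr_ge0.
  exact: psd_compl_proj.
- by rewrite /beta0 e -scalemxAr retrZ.
- rewrite /beta1 mulmxBr mulmx1 retrB -scalemxAr retrZ mulmxBr mulmx1 retrB.
  by rewrite trace_tpow hr1.2 expr1n /=; ring.
Qed.

(* Mixing the block test with the identity makes its second error exactly
   [expR (- n b)], so that the rate converges along all [n]. *)
Lemma direct_test m (b : R) : (0 < m)%N -> 0 < b -> m%:R * b < x m ->
  exists T, admissible u rho0 T /\
    \forall n \near \oo, beta1 rho1 (T n) = expR (- (n%:R * b)).
Proof.
(* The midpoint [c] leaves room above [m b]: the loss from the incomplete last block is absorbed for
   large [n]. *)
move=> m0 b0 hb; pose c := (m%:R * b + x m) / 2.
have m0R : 0 < m%:R :> R by rewrite ltr0n.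
have hc1 : m%:R * b < c by rewrite /c; lra.
have hc2 : c < x m by rewrite /c; lra.
have hc0 : 0 < c by apply: lt_trans hc1; rewrite mulr_gt0.
have [th /andP[th0 th1] hth] := block_test hc2.
have hT0 n : exists T : 'M[C]_(d ^ n), [/\ adj T = T, T *m T = T, in_An u T,
    beta0 rho0 T <= 2 * th ^+ (n %/ m) & beta1 rho1 T <= expR (- ((n %/ m)%:R * c))].
  by have := hth (n %/ m)%N (n %% m)%N; rewrite mulnC -divn_eq.
have hT n : exists T : 'M[C]_(d ^ n),
    [/\ in_An u T, loewner_le 0 T /\ loewner_le T 1%:M, beta0 rho0 T <= 2 * th ^+ (n %/ m) &
    n%:R * b <= (n %/ m)%:R * c -> (0 < n)%N -> beta1 rho1 T = expR (- (n%:R * b))].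
  have [T [aT TT cT h0 h1]] := hT0 n.
  have [/andP[hn n0]|hn] := boolP ((n%:R * b <= (n %/ m)%:R * c) && (0 < n)%N); last first.
    exists T; split=> // [|h2 h3]; last by rewrite h2 h3 in hn.
    rewrite /loewner_le subr0; split; [exact: psd_proj|exact: psd_compl_proj].
  have hlt : expR (- (n%:R * b)) < 1 by rewrite expR_lt1 oppr_lt0 mulr_gt0 // ltr0n.
  have hle : beta1 rho1 T <= expR (- (n%:R * b)).
    by apply: (le_trans h1); rewrite ler_expR lerN2.
  have hb1 : 0 < 1 - beta1 rho1 T by rewrite subr_gt0 (le_lt_trans hle).
  (* The solution of [beta1 + lam (1 - beta1) = expR (- (n b))]. *)
  pose lam := (expR (- (n%:R * b)) - beta1 rho1 T) / (1 - beta1 rho1 T).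
  have l0 : 0 <= lam by rewrite divr_ge0 ?(ltW hb1) // subr_ge0.
  have l1 : lam <= 1 by rewrite ler_pdivrMr // mul1r lerB // ltW.
  have [|T' [cT' eT' b0' b1']] := mix_test (lam := lam) aT TT cT; first by rewrite l0.
  exists T'; split=> //; last by rewrite b1' mulfVK ?gt_eqF // subrKC.
  rewrite b0'; apply: le_trans h0; apply: ler_piMl; last lra.
  by apply: beta0_ge0; apply: psd_compl_proj.
pose T n := projT1 (cid (hT n)); have HT n := projT2 (cid (hT n)); exists T; split; [split|].
- by move=> n; have [h1 [h2 h3] _ _] := HT n.
- apply: (@squeeze_cvgr _ _ _ _ (cst 0) (fun n => 2 * th ^+ (n %/ m)%N)).
  + apply: nearW => n; have [_ [_ h2] h3 _] := HT n; apply/andP; split; last exact: h3.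
    exact: beta0_ge0.
  + exact: cvg_cst.
  + rewrite -[X in _ --> X](mulr0 2); apply: cvgM; first exact: cvg_cst.
    have hdiv : (n %/ m)%N @[n --> \oo] --> \oo.
      move=> A [N _ hN]; exists (N * m)%N => // n /= hn; apply: hN => /=.
      by rewrite leq_divRL.
    apply: (@cvg_comp _ _ _ (fun n => (n %/ m)%N) (fun k => th ^+ k)); first exact: hdiv.
    by apply: cvg_expr; rewrite ger0_norm.
(* From this length on, [n <= (n %/ m + 1) m] implies [n b <= (n %/ m) c]. *)
have hlarge := nbhs_infty_ger (m%:R * c / (c - m%:R * b)).
have hpos : \forall n \near \oo, (0 < n)%N by exists 1%N.
apply: filterS2 hlarge hpos => n hn n0; have [_ _ _ h] := HT n; apply: h => //.
move: hn; rewrite ler_pdivrMr ?subr_gt0 // => hn.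
have hk : n%:R <= ((n %/ m)%:R + 1) * m%:R :> R.
  by rewrite natr1 -natrM ler_nat ltnW // ltn_ceil.
rewrite -(ler_pM2l m0R); nra.
Qed.

(** The bound on [x n] stays inside the eventual statement: it is used both when it holds for all
    [n] and to refute it at a single large [n]. *)
Lemma beta_converse T (s e : R) : admissible u rho0 T -> 0 <= s -> 0 < e ->
  \forall n \near \oo, x n <= n%:R * s -> expR (- (n%:R * (s + e))) <= beta1 rho1 (T n).
Proof.
(* [1 - s / (s + del)] equals [2 c]; one [c] pays for the additive constant 1 in
   [relent_test_bound], the other remains as the lower bound. *)
move=> [hT hT0] s0 e0; pose del := e / 2; pose c := del / (2 * (s + del)).
have del0 : 0 < del by rewrite /del; lra.
have sd0 : 0 < s + del by lra.
have c0 : 0 < c by rewrite /c divr_gt0 //; lra.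
have hc : c * (2 * (s + del)) = del by rewrite /c mulfVK // gt_eqF //; lra.
have hb0 : \forall n \near \oo, beta0 rho0 (T n) <= c / 4.
  have /cvgrPdist_le/(_ (c / 4)) := hT0; rewrite divr_gt0 // => /(_ isT).
  by apply: filterS => n; rewrite sub0r normrN; apply: le_trans; exact: ler_norm.
have hn1 := nbhs_infty_ger (2 / del); have hn2 := nbhs_infty_ger (4 / (c * del)).
apply: filterS3 hb0 hn1 hn2 => n hb; rewrite ler_pdivrMr // => hn1.
rewrite ler_pdivrMr ?(mulr_gt0 c0) // => hn2 hx.
have n0 : 0 < n%:R :> R.
  by rewrite lt_neqAle ler0n andbT eq_sym; apply/eqP => h; move: hn1; rewrite h mul0r; lra.
have [hAn [hT1 hT2]] := hT n; rewrite /loewner_le subr0 in hT1.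
pose a := n%:R * (s + del); have a0 : 0 < a by rewrite mulr_gt0.
have := relent_test_bound (density_rho_n n hr0) (density_rho_n n hr1) (hsupp n) hT1 hT2 a0.
rewrite -/(x n) (EA_trace_test hG hmu hu) ?(EA_trace_test hG hmu hu) //; last first.
  by apply: in_AnB => //; exact: in_An1.
rewrite -/(beta0 rho0 (T n)) -/(beta1 rho1 (T n)).
have h1 : c <= 1 - a^-1 * (1 + x n).
  rewrite lerBrDl -lerBrDr ler_pdivrMl //.
  have : n%:R * s + 1 <= a * (1 - c).
    have hac : a * c = n%:R * (c * (2 * (s + del))) / 2 by rewrite /a; field.
    rewrite mulrBr mulr1 hac hc /a; lra.
  lra.
move=> h2; have h3 : c / 4 <= expR a * beta1 rho1 (T n) by lra.
(* The constant [c / 4] costs the second half [del] of the margin [e]. *)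
have h4 : expR (- (n%:R * del)) <= c / 4.
  have h5 : 4 / c <= n%:R * del by rewrite ler_pdivrMr //; lra.
  have := expR_ge1Dx (n%:R * del); rewrite expRN => h6.
  have h7 : (4 / c) <= expR (n%:R * del) by lra.
  by rewrite -[c / 4]invrK invf_div lef_pV2 ?posrE ?expR_gt0 // divr_gt0.
have -> : - (n%:R * (s + e)) = - (n%:R * del) - a by rewrite /a /del; field.
rewrite expRD (expRN a) ler_pdivrMr ?expR_gt0 // (le_trans h4) // [leRHS]mulrC.
exact: h3.
Qed.

Let S : \bar R := ereal_sup [set ((n%:R)^-1 * x n)%:E | n in [set n | (0 < n)%N]].

Lemma term_le_sup n : (0 < n)%N -> (((n%:R)^-1 * x n)%:E <= S)%E.
Proof. by move=> n0; apply: ereal_sup_ubound; exists n. Qed.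

Lemma x_ge n : -1 <= x n.
Proof. by apply: relent_ge; [exact: density_rho_n|exact: density_rho_n|exact: hsupp]. Qed.

Lemma sup_attained (t : R) : (t%:E < S)%E -> exists2 m, (0 < m)%N & m%:R * t < x m.
Proof.
move=> /ereal_sup_gt[_ [m m0 <-]]; rewrite lte_fin => h; exists m => //.
by rewrite -ltr_pdivlMl // ltr0n.
Qed.

(** For [t >= 0] take a test with second error [expR (- (n b))] and [b > t]. If [x n <= n t] at a
    large [n], the converse would force a larger second error. For [t < 0], [x n >= -1] suffices. *)
Lemma sup_le_eventually (t : R) : (t%:E < S)%E ->
  \forall n \near \oo, t <= (n%:R)^-1 * x n.
Proof.
move=> ht; have hpos : \forall n \near \oo, (0 < n)%N by exists 1%N.
have [t0|t0] := ltP t 0.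
  apply: filterS2 (nbhs_infty_ger (- t^-1)) hpos => n hn n0.
  rewrite ler_pdivlMl ?ltr0n //; apply: le_trans (x_ge n).
  have : - t * - t^-1 <= - t * n%:R by rewrite ler_wpM2l //; lra.
  by rewrite mulrNN divff ?lt_eqF // mulNr mulrC lerNr.
have [m m0 hm] := sup_attained ht.
have m0R : 0 < m%:R :> R by rewrite ltr0n.
pose b := (t + x m / m%:R) / 2.
have hm' : t < x m / m%:R by rewrite ltr_pdivlMr // mulrC.
have hb1 : t < b by rewrite /b; lra.
have hb2 : m%:R * b < x m by rewrite mulrC -ltr_pdivlMr // /b; lra.
have [T [hT hb]] := direct_test m0 (le_lt_trans t0 hb1) hb2.
have he : 0 < (b - t) / 2 by lra.
apply: filterS3 hb (beta_converse hT t0 he) hpos => n -> h n0.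
rewrite ler_pdivlMl ?ltr0n // leNgt; apply/negP => /ltW/h.
rewrite ler_expR lerN2 ler_pM2l ?ltr0n //; lra.
Qed.

Lemma sup_ge0 : (0 <= S)%E.
Proof.
apply: lee_real_below => t; rewrite lte_fin => t0.
have hpos : \forall n \near \oo, (0 < n)%N by exists 1%N.
have [n [hn n0]] : exists n, - t^-1 <= n%:R /\ (0 < n)%N.
  have [N _ hN] : \forall n \near \oo, - t^-1 <= n%:R /\ (0 < n)%N.
    by apply: filterS2 (nbhs_infty_ger (- t^-1)) hpos.
  by exists N; apply: hN => /=.
apply: le_trans (term_le_sup n0); rewrite lee_fin ler_pdivlMl ?ltr0n //.
apply: le_trans (x_ge n).
have : - t * - t^-1 <= - t * n%:R by rewrite ler_wpM2l //; lra.
by rewrite mulrNN divff ?lt_eqF // mulNr mulrC lerNr.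
Qed.

Lemma S_M_sup : S_M mu u rho0 rho1 = S.
Proof.
apply/cvg_lim => //; apply: cvg_einf_esup.
  apply: lee_real_below => t /sup_le_eventually h; apply: limn_einf_ge.
  by apply: filterS h => n hn; rewrite (relent_fin (hsupp n)) -EFinM lee_fin.
apply: limn_esup_le; exists 1%N => // n /= n0.
by rewrite (relent_fin (hsupp n)) -EFinM; apply: term_le_sup.
Qed.

Lemma rate_gt T n : 0 < beta1 rho1 (T n) ->
  rate rho1 T n = ((n%:R)^-1 * ln (beta1 rho1 (T n)))%:E.
Proof. by rewrite /rate /elog => ->; rewrite EFinM. Qed.

Lemma s_lim_le (t : R) : (t%:E < S)%E -> (s_lim u rho0 rho1 <= (- t)%:E)%E.
Proof.
move=> ht; have [t0|t0] := leP t 0.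
  (* For [t <= 0] the identity test is enough: its rate is constantly 0. *)
  apply: (@le_trans _ _ 0%E); last by rewrite lee_fin oppr_ge0.
  apply: ereal_inf_lbound; exists (fun n => 1%:M); split; [split|].
  - move=> n; split; first exact: in_An1.
    rewrite /loewner_le subr0; split; first exact: psd1.
    by apply: psd_compl_proj; rewrite ?adj_mx1 ?mulmx1.
  - rewrite (_ : (fun n => _) = cst 0); first exact: cvg_cst.
    by apply/funext => n; rewrite /beta0 subrr mulmx0 mxtrace0.
  - rewrite (_ : rate _ _ = cst 0%E); first exact: cvg_cst.
    apply/funext => n; have e : beta1 rho1 (1%:M : 'M[C]_(d ^ n)) = 1.
      by rewrite /beta1 mulmx1 trace_tpow hr1.2 expr1n.
    by rewrite rate_gt e // ln1 mulr0.
have [m m0 hm] := sup_attained ht; have [T [hT hb]] := direct_test m0 t0 hm.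
apply: ereal_inf_lbound; exists T; split=> //.
have hpos : \forall n \near \oo, (0 < n)%N by exists 1%N.
apply: cvg_near_cst; apply: filterS2 hb hpos => n hn n0.
rewrite rate_gt hn ?expR_gt0 // expRK -mulrN mulKf //.
by rewrite pnatr_eq0 -lt0n.
Qed.

Lemma s_lim_le_sup : (s_lim u rho0 rho1 <= - S)%E.
Proof.
rewrite leeNr; apply: lee_real_below => t /s_lim_le.
by rewrite EFinN leeNr.
Qed.

Lemma s_lower_ge : (- S <= s_lower u rho0 rho1)%E.
Proof.
apply: le_ereal_inf_tmp => _ [T [hT ->]].
apply: lee_real_below => t; rewrite lteNr -EFinN => ht.
(* A real [t] below [- S] exists only when [S] is finite; the converse then applies with [s = S] and
   margin [- t - S]. *)
have t0 : t < 0 by have := le_lt_trans sup_ge0 ht; rewrite lte_fin oppr_gt0.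
have hS : S \is a fin_num.
  by rewrite ge0_fin_numE ?sup_ge0 // (lt_trans ht) // ltry.
pose s := fine S; have hs : S = s%:E by rewrite fineK.
have s0 : 0 <= s by have := sup_ge0; rewrite hs lee_fin.
have st : s < - t by rewrite hs lte_fin in ht.
have he : 0 < - t - s by lra.
have hpos : \forall n \near \oo, (0 < n)%N by exists 1%N.
apply: limn_einf_ge; apply: filterS2 (beta_converse hT s0 he) hpos => n h n0.
have n0R : 0 < n%:R :> R by rewrite ltr0n.
have hx : x n <= n%:R * s.
  by have := term_le_sup n0; rewrite hs lee_fin ler_pdivrMl.
have {h} := h hx; rewrite subrKC mulrN opprK => h.
have hb : 0 < beta1 rho1 (T n) by apply: lt_le_trans h; exact: expR_gt0.
rewrite rate_gt // lee_fin ler_pdivlMl // -[X in X <= _]expRK ler_ln // posrE; exact: expR_gt0.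
Qed.

Lemma s_lower_le_upper : (s_lower u rho0 rho1 <= s_upper u rho0 rho1)%E.
Proof.
apply: le_ereal_inf_tmp => _ [T [hT ->]]; apply: le_trans (limn_einf_sup _).
by apply: ereal_inf_lbound; exists T.
Qed.

Lemma s_upper_le_lim : (s_upper u rho0 rho1 <= s_lim u rho0 rho1)%E.
Proof.
apply: le_ereal_inf_tmp => l [T [hT hl]]; apply: ereal_inf_lbound; exists T; split=> //.
by rewrite (cvg_limn_einf_sup hl).2.
Qed.

End Main.

Theorem theorem4p4 (R : realType) (G : ptopologicalType)
  (mul : G -> G -> G) (inv : G -> G) (one : G)
  (mu : {measure set (borel G) -> \bar R})
  (d : nat) (u : G -> 'M[R[i]]_d) (rho0 rho1 : 'M[R[i]]_d) :
  compact_group mul inv one ->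
  normalized_haar mul mu ->
  unitary_rep mul one u ->
  density rho0 -> density rho1 ->
  (forall n : nat, loewner_le (supp (rho_n mu u rho0 n)) (supp (rho_n mu u rho1 n))) ->
  s_lower u rho0 rho1 = s_upper u rho0 rho1 /\
  s_upper u rho0 rho1 = s_lim u rho0 rho1 /\
  s_lim u rho0 rho1 = (- S_M mu u rho0 rho1)%E.
Proof.
move=> hG hmu hu hr0 hr1 hsupp; rewrite (S_M_sup hG hmu hu hr0 hr1 hsupp).
(* The inequalities form the cycle [s_lim <= - S <= s_lower <= s_upper <= s_lim]. *)
have h1 := s_lim_le_sup hG hmu hu hr0 hr1 hsupp.
have h2 := s_lower_ge hG hmu hu hr0 hr1 hsupp.
have h3 := s_lower_le_upper u rho0 rho1; have h4 := s_upper_le_lim u rho0 rho1.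
split; [|split]; apply/eqP; rewrite eq_le.
- by rewrite h3 (le_trans h4 (le_trans h1 h2)).
- by rewrite h4 (le_trans h1 (le_trans h2 h3)).
- by rewrite h1 (le_trans h2 (le_trans h3 h4)).
Qed.
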